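(* Let $d\ge 1$ be an integer, $a>0$, $\lambda>0$ and $0<\epsilon<a/4$. Let $\omega$ be a Poisson point process on the torus $\mathbb{T}_a^d$ with intensity measure $\lambda\,dx$, and let $\chi$ be the Euler characteristic of the Čech complex $\mathcal{C}_\epsilon(\omega)$. Then $$\operatorname{Var}[\chi]=\lambda a^d\sum_{n=1}^{\infty}c_n^d\,\bigl(\lambda(2\epsilon)^d\bigr)^{n-1},$$ where (the superscript $d$ in $c_n^d$ being an index, not a power) $$c_n^d=\sum_{j=\lceil (n+1)/2\rceil}^{n}\left[2\sum_{i=n-j+1}^{j}\frac{(-1)^{i+j}}{(n-j)!\,(n-i)!\,(i+j-n)!}\left(n+\frac{2(n-i)(n-j)}{1+i+j-n}\right)^d-\frac{1}{(n-j)!^2\,(2j-n)!}\left(n+\frac{2(n-j)^2}{1+2j-n}\right)^d\right].$$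
   Context: $\mathbb{T}_a^d=\mathbb{R}^d/a\mathbb{Z}^d$, identified with $X=[0,a)^d$, is equipped with Lebesgue measure and the distance $\rho_d(x,y)=\inf_{m\in\mathbb{Z}^d}\|x-y+ma\|_\infty$. For a finite set $\omega\subset\mathbb{T}_a^d$, the Čech complex $\mathcal{C}_\epsilon(\omega)$ is the abstract simplicial complex with vertex set $\omega$ in which distinct points $v_0,\dots,v_k\in\omega$ form a $k$-simplex if and only if $\bigcap_{i=0}^k B(v_i,\epsilon)\neq\emptyset$, where $B(v,\epsilon)=\{y:\rho_d(v,y)<\epsilon\}$. The Euler characteristic is $\chi(\omega)=\sum_{i\ge 0}(-1)^i s_i(\omega)$, where $s_i(\omega)$ is the number of $i$-simplices (equivalently, the alternating sum of the Betti numbers). A Poisson point process with intensity measure $\lambda\,dx$ is a random finite set $\omega$ such that the number of points in any Borel set $A$ is Poisson with mean $\lambda|A|$, with independence over disjoint sets. *)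

(* Defs.v *)
From HB Require Import structures.
From mathcomp Require Export all_boot all_order all_algebra finmap.
From mathcomp Require Export all_classical all_reals all_analysis.

Set Implicit Arguments.
Unset Strict Implicit.
Unset Printing Implicit Defensive.

Import Order.TTheory GRing.Theory Num.Theory.
Import numFieldNormedType.Exports.

Local Open Scope fset_scope.
Local Open Scope classical_set_scope.
Local Open Scope ring_scope.

Section Torus.
Context {R : realType}.

(* d-dimensional Lebesgue measure as the iterated product of the
   one-dimensional one: the successor case is the library's
   [lebesgue_measure \x lebesgue_tuple n], read on n.+1.-tuples. *)
Fixpoint lebesgue_tuple (n : nat) : set (n.-tuple R) -> \bar R :=
  match n with
  | 0 => fun A => (\d_[tuple] A)%E
  | m.+1 => fun A => (\int[lebesgue_measure]_x
      lebesgue_tuple [set v : m.-tuple R | A [tuple of x :: v]])%E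
  end.

Context {d : nat}.
Implicit Types (a eps : R) (x y v : d.-tuple R) (s w : {fset d.-tuple R}).

(* The torus is identified with its fundamental domain [0, a)^d, so that its
   Borel sets are the measurable subsets of [d.-tuple R] it contains. *)
Definition torus a : set (d.-tuple R) :=
  [set x | forall i, 0 <= tnth x i < a].

Definition torus_dist a x y : R :=
  inf [set \big[Num.max/0]_(i < d) `|tnth x i - tnth y i + (m i)%:~R * a|
      | m in [set: 'I_d -> int]].

Definition torus_ball a v eps : set (d.-tuple R) :=
  [set y | torus a y /\ torus_dist a v y < eps].

Definition cech a eps w : {fset {fset d.-tuple R}} :=
  [fset s in fpowerset w | (s != fset0) &&
    `[< \bigcap_(v in [set` s]) torus_ball a v eps !=set0 >]].

Definition nb_simplices a eps w (i : nat) : nat :=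
  #|` [fset s in cech a eps w | #|` s| == i.+1]|.

(* Simplices have dimension < #|` w|, so truncating the sum loses nothing. *)
Definition euler_char a eps w : int :=
  \sum_(i < #|` w|) (-1) ^+ i * (nb_simplices a eps w i)%:Z.

End Torus.

Section PoissonProcess.
Context {R : realType} {disp : measure_display} {Omega : measurableType disp}.
Variable P : probability Omega R.

Definition independent_counts (I : finType) (X : I -> Omega -> nat) : Prop :=
  forall B : I -> set nat,
    fine (P (\bigcap_i (X i @^-1` B i))) = \prod_i fine (P (X i @^-1` B i)).

Context {d : nat}.
Implicit Types (omega : Omega -> {fset d.-tuple R}) (A : set (d.-tuple R)).

Definition count_in omega A (t : Omega) : nat :=
  #|` [fset x in omega t | x \in A]|.

(* The second argument of [poisson_prob] is ignored by the library; at rate 0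
   the distribution is the Dirac mass at 0. *)
Definition poisson_process (a lambda : R) omega : Prop :=
  [/\ forall t x, x \in omega t -> torus a x,
      forall A, measurable A -> A `<=` torus a ->
        measurable_fun [set: Omega] (count_in omega A),
      forall A, measurable A -> A `<=` torus a -> forall B : set nat,
        P (count_in omega A @^-1` B) =
          poisson_prob (lambda * fine (lebesgue_tuple A)) 0 B
    & forall (n : nat) (A : 'I_n -> set (d.-tuple R)),
        (forall i, measurable (A i)) -> (forall i, A i `<=` torus a) ->
        trivIset [set: 'I_n] A ->
        independent_counts (fun i => count_in omega (A i))].

End PoissonProcess.

(* [uphalf n.+1] is the ceiling of (n + 1) / 2.  On the ranges of summation
   i <= j <= n and n < i + j, so no subtraction in nat is truncated. *)
Definition var_coef (R : realType) (d n : nat) : R :=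
  \sum_(uphalf n.+1 <= j < n.+1)
    (2 * (\sum_(n - j + 1 <= i < j.+1)
        (-1) ^+ (i + j) / ((n - j)`! * (n - i)`! * (i + j - n)`!)%:R *
        (n%:R + (2 * (n - i) * (n - j))%:R / (1 + i + j - n)%:R) ^+ d)
     - 1 / ((n - j)`! ^ 2 * (2 * j - n)`!)%:R *
       (n%:R + (2 * (n - j) ^ 2)%:R / (1 + 2 * j - n)%:R) ^+ d).

(* Main.v *)
Require Import Defs.
From mathcomp Require Import all_boot all_order all_algebra finmap.
From mathcomp Require Import all_classical all_reals all_analysis.
From mathcomp Require Import measurable_realfun zify ring lra.
Import Order.TTheory GRing.Theory Num.Theory.
Import numFieldNormedType.Exports.
Local Open Scope classical_set_scope.
Local Open Scope ring_scope.

(* Cut the torus into M^d cells (M = N + 1).  The occupied cells are independent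
   with a common probability p ~ lambda (a / M)^d, and for M large the Euler
   characteristic of the Cech complex equals that of a complex on the occupied
   cells: a set of cells is a simplex when, in each coordinate, it lies in an arc
   of about 2 eps M / a points of Z/M.  The variance of this discrete Euler
   characteristic is a finite sum over pairs (S, T) of sets of cells, in which
   disjoint pairs cancel.  The pairs with #|S :|: T| = n contribute p^n / n! times
   a sum over the coverings 'I_n = A :|: B, A and B meeting, of the number of
   injections of 'I_n into the cells that map A and B to simplices; up to a
   negligible proportion of non-injective maps this number is the d-th power of a
   number of maps into Z/M.  The latter has a closed form (2 eps < a / 2 prevents
   wrapping around the circle), equivalent to
     M^n (2 eps / a)^(n-1) (n + 2 #|A :\: B| #|B :\: A| / (1 + #|A :&: B|)).
   Dominated convergence, for the series in n (terms at most
   (4 lambda a^d)^n / n!) and for the moments (|chi| <= 2^#|omega|), gives the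
   formula as M tends to infinity. *)

(** * Arcs of the discrete circle *)

Section ArcCount.
Import mathcomp.boot.fintype mathcomp.boot.finset.
Local Open Scope set_scope.

(** Offsets are taken in Z/(N + 1). Only [s] = 0 and [s] = 1 occur: the arc of length [L] starting
    at [y], and the same arc deprived of [y]. *)
Definition arc {N : nat} (s L : nat) (y : 'I_N.+1) : {set 'I_N.+1} :=
  [set x : 'I_N.+1 | (s <= (x - y)%R < L)%N].

Definition in_arc {N : nat} (L : nat) (U : {set 'I_N.+1}) : bool :=
  [exists y : 'I_N.+1, U \subset arc 0 L y].

Lemma val_ZpB (N : nat) (x y : 'I_N.+1) :
  nat_of_ord (x - y)%R = if (y <= x)%N then (x - y)%N else (x + N.+1 - y)%N.
Proof.
case: x y => x xN [y yN] /=.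
rewrite modnDmr; case: leqP => yx.
  by rewrite addnBA ?(ltnW yN)// -addnBAC// modnDr modn_small//; lia.
by rewrite modn_small; lia.
Qed.

Lemma card_nat_range (n b c : nat) : (c <= n)%N ->
  #|[set x : 'I_n | (b <= x < c)%N]| = (c - b)%N.
Proof.
move=> cn; rewrite -sum1_card (eq_bigl (fun i : 'I_n => (b <= i < c)%N)); last first.
  by move=> i; rewrite inE.
rewrite -(big_mkord (fun i => (b <= i < c)%N) (fun _ => 1%N)).
have [bc|cb] := leqP b c; last first.
  rewrite big_pred0; last by move=> i; lia.
  lia.
rewrite (big_cat_nat (n := b)) ?(leq_trans bc)//= (big_cat_nat (m := b) (n := c))//=.
rewrite [X in (X + _)%N]big_nat_cond big_pred0; last by move=> i; lia.
rewrite [X in (0 + (_ + X))%N]big_nat_cond [X in (0 + (_ + X))%N]big_pred0; last by move=> i; lia.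
rewrite addn0 add0n big_nat_cond (eq_bigl (fun i => (b <= i < c)%N && true)); last first.
  by move=> i; rewrite andbT andbb.
by rewrite -big_nat_cond sum_nat_const_nat muln1.
Qed.

Context {N l : nat}.
Hypothesis lN : (2 * l.+1 <= N.+1)%N.

(* Since an arc is at most half of the circle, [U] has at most one first point. *)
Lemma in_arc_card (U : {set 'I_N.+1}) : U != set0 ->
  (in_arc l.+1 U : nat) = #|[set y in U | U \subset arc 0 l.+1 y]|.
Proof.
move=> /set0Pn[u0 u0U]; rewrite /in_arc; case: existsP => [[y Uy]|nU] /=; last first.
  apply/esym/eqP; rewrite cards_eq0 -subset0; apply/subsetP => y.
  by rewrite inE => /andP[_ Uy]; case: nU; exists y.
have [u uU umin] : exists2 u, u \in U & forall v, v \in U -> ((u - y)%R <= (v - y)%R)%N.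
  by have [u uU um] := @arg_minnP _ u0 (mem U) (fun v => nat_of_ord (v - y)%R) u0U; exists u.
apply/esym/eqP/cards1P; exists u; apply/setP => v; rewrite !inE.
apply/andP/eqP => [[vU Uv]|->].
  apply/val_inj/eqP; rewrite /= eqn_leq.
  move: (subsetP Uv _ uU); rewrite !inE.
  have := subsetP Uy _ vU; have := subsetP Uy _ uU; rewrite !inE.
  have := umin _ vU; rewrite !val_ZpB /=.
  have := ltn_ord u; have := ltn_ord v; have := ltn_ord y.
  by clear -lN; do 3 (case: ifPn => ?); lia.
split=> //; apply/subsetP => w wU; rewrite !inE.
have := subsetP Uy _ wU; have := subsetP Uy _ uU; rewrite !inE.
have := umin _ wU; rewrite !val_ZpB /=.
have := ltn_ord u; have := ltn_ord w; have := ltn_ord y.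
by clear -lN; do 3 (case: ifPn => ?); lia.
Qed.

(* Turns the indicator of a simplex into a signed sum of indicators of product
   sets, whose preimages under maps are easily counted. *)
Lemma in_arcE (R : pzRingType) (U : {set 'I_N.+1}) : U != set0 ->
  (in_arc l.+1 U)%:R =
  \sum_y \sum_(s < 2) (-1) ^+ s * (U \subset arc s l.+1 y)%:R :> R.
Proof.
move=> U0; rewrite in_arc_card// -sum1_card natr_sum big_mkcond /=.
apply: eq_bigr => y _; rewrite !big_ord_recl big_ord0 addr0 !expr0 expr1 mul1r mulN1r !inE /=.
(* If [y] is in [U], the arc without [y] cannot contain [U], and what remains is the indicator
   counted by [in_arc_card]. If not, the two inclusions are equivalent and cancel. *)
have [yU|yU] /= := boolP (y \in U).
  have -> : (U \subset arc 1 l.+1 y) = false.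
    by apply/negP => /subsetP/(_ _ yU); rewrite !inE subrr.
  by rewrite subr0; case: ifP.
have -> : (U \subset arc 1 l.+1 y) = (U \subset arc 0 l.+1 y); last by rewrite subrr.
apply/subsetP/subsetP => Uy x xU; have := Uy x xU; rewrite !inE /=.
  by case/andP.
move=> ->; rewrite andbT lt0n; apply: contra yU => /eqP xy.
suff -> : y = x by [].
by apply/esym/eqP; rewrite -subr_eq0; apply/eqP/val_inj.
Qed.

Lemma card_arc (s : nat) (y : 'I_N.+1) : #|arc s l.+1 y| = (l.+1 - s)%N.
Proof.
rewrite -(@card_nat_range N.+1 s l.+1); last lia.
rewrite -(card_imset _ (@addIr _ y)); apply/eq_card => x.
apply/idP/imsetP => [|[z]].
  by rewrite inE => xs; exists (x - y); rewrite ?subrK// inE.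
by rewrite !inE => zs ->; rewrite addrK.
Qed.

(** Arcs of at most half the circle meet in a single interval: either the second starts inside the
    first, or it wraps round and can only meet the beginning of the first. *)
Lemma card_arcI (s t : nat) (y z : 'I_N.+1) : (s <= 1)%N -> (t <= 1)%N ->
  #|arc s l.+1 y :&: arc t l.+1 z| =
  (if ((z - y)%R < l.+1)%N then l.+1 - maxn s ((z - y)%R + t)
   else l.+1 - (N.+1 - (z - y)%R) - s)%N.
Proof.
move=> s1 t1; set w : 'I_N.+1 := z - y.
transitivity (#|[set x : 'I_N.+1 | (s <= x < l.+1)%N && (t <= (x - w)%R < l.+1)%N]|).
  rewrite -[RHS](card_imset _ (@addIr _ y)); apply/eq_card => x.
  apply/idP/imsetP => [|[v]]; rewrite !inE.
    by move=> xs; exists (x - y); rewrite ?subrK// inE /w opprB addrA subrK.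
  by move=> /andP[vs vt] ->; rewrite addrK vs -addrA -opprB.
have wN := ltn_ord w.
case: ifPn => wl.
  rewrite -(@card_nat_range N.+1); last lia.
  apply: eq_card => x; rewrite !inE val_ZpB; have := ltn_ord x.
  by case: ifPn; lia.
rewrite -(@card_nat_range N.+1); last lia.
apply: eq_card => x; rewrite !inE val_ZpB; have := ltn_ord x.
by case: ifPn; lia.
Qed.

Definition sum_pow (k m : nat) : nat := \sum_(j < m) j ^ k.

(** As [z] goes round the circle, the overlap grows from 0 to its maximum and shrinks back. With
    both base points each value 1..l occurs twice and [l.+1] once; with one base point removed only
    the former remain; with both removed [l] occurs once only. Corrections are added on either side
    to avoid truncated subtraction. *)
Lemma sum_card_arcI (s t k : nat) (y : 'I_N.+1) : (0 < k)%N ->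
  (s <= 1)%N -> (t <= 1)%N ->
  (\sum_z #|arc s l.+1 y :&: arc t l.+1 z| ^ k + s * t * l ^ k =
   2 * sum_pow k l.+1 + (1 - s) * (1 - t) * l.+1 ^ k)%N.
Proof.
move=> k0 s1 t1; under eq_bigr do rewrite card_arcI//.
rewrite (reindex_inj (addIr y)).
under eq_bigr do rewrite addrK.
pose F w := ((if (w < l.+1) then l.+1 - maxn s (w + t)
   else l.+1 - (N.+1 - w) - s) ^ k)%N.
rewrite -(big_mkord xpredT F) (big_cat_nat (n := l.+1)) //=; last lia.
have -> : (\sum_(l.+1 <= i < N.+1) F i = \sum_(j < l.+1) (j - s) ^ k)%N.
  (* Before this offset the arcs are disjoint, and [k0] makes their terms vanish; the last [l.+1]
     offsets come from wrapping round. *)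
  rewrite (big_cat_nat (n := (N.+1 - l.+1)%N)) //=; [|lia|lia].
  rewrite big_nat_cond big1 ?add0n; last first.
    move=> i /andP[/andP[li iN] _]; rewrite /F ifN; last lia.
    have -> : (l.+1 - (N.+1 - i) - s = 0)%N by lia.
    by rewrite exp0n.
  rewrite -{1}[(N.+1 - l.+1)%N]add0n big_addn.
  have -> : (N.+1 - (N.+1 - l.+1) = l.+1)%N by lia.
  rewrite big_mkord; apply: eq_bigr => i _; rewrite /F ifN; last lia.
  by congr (_ ^ _)%N; have := ltn_ord i; lia.
have -> : (\sum_(0 <= i < l.+1) F i = \sum_(i < l.+1) (l.+1 - maxn s (i + t)) ^ k)%N.
  by rewrite big_mkord; apply: eq_bigr => i _; rewrite /F ltn_ord.
have rev (h : nat -> nat) : (\sum_(i < l.+1) h (l - i) = \sum_(i < l.+1) h i)%N.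
  rewrite [RHS](reindex_inj rev_ord_inj) /=; apply: eq_bigr => i _.
  by congr h; lia.
have Srec : sum_pow k l.+1 = (\sum_(i < l) i.+1 ^ k)%N.
  by rewrite /sum_pow big_ord_recl exp0n// add0n; apply: eq_bigr => i _.
have Srec' : sum_pow k l.+1 = (\sum_(i < l) i ^ k + l ^ k)%N.
  by rewrite /sum_pow big_ord_recr.
have S1 : (\sum_(i < l.+1) (i - 1) ^ k = \sum_(i < l) i ^ k)%N.
  rewrite big_ord_recl sub0n exp0n// add0n; apply: eq_bigr => i _.
  by rewrite lift0 subn1.
have S2 : (\sum_(i < l.+1) i.+1 ^ k = sum_pow k l.+1 + l.+1 ^ k)%N.
  by rewrite big_ord_recr /= Srec.
have S3 : (\sum_(i < l.+1) (l - i) ^ k = sum_pow k l.+1)%N.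
  by rewrite (rev (fun i => i ^ k)%N).
case: s t s1 t1 F => [|[|//]] [|[|//]] _ _ F; rewrite ?subn0 ?subnn ?mul0n ?mul1n ?addn0.
- under eq_bigr => i _ do rewrite max0n addn0 subSn ?leq_ord//.
  rewrite (rev (fun i => i.+1 ^ k)%N) S2.
  under eq_bigr => i _ do rewrite subn0.
  by rewrite -/(sum_pow k l.+1); lia.
- under eq_bigr => i _ do rewrite max0n addn1 subSS.
  rewrite S3.
  under eq_bigr => i _ do rewrite subn0.
  by rewrite -/(sum_pow k l.+1); lia.
- rewrite big_ord_recl [maxn _ _]/= addn0 subSS subn0 S1.
  under eq_bigr => i _ do rewrite lift0 addn0 (maxn_idPr _)// subSS.
  have -> : (\sum_(i < l) (l - i) ^ k)%N = (\sum_(i < l.+1) (l - i) ^ k)%N.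
    by rewrite big_ord_recr /= subnn exp0n// addn0.
  by rewrite S3; lia.
- under eq_bigr => i _ do rewrite addn1 (maxn_idPr _)// subSS.
  by rewrite S3 S1; lia.
Qed.

End ArcCount.

(** * Maps sending two given sets into arcs *)

Section PairCount.
Import mathcomp.boot.fintype mathcomp.boot.finset.
Local Open Scope set_scope.

(** The values of [g] are chosen independently: in [J] on [A :\: B], in [K] on [B :\: A], in
    [J :&: K] on [A :&: B]. *)
Lemma card_ffun_imset_sub2 (I T : finType) (A B : {set I}) (J K : {set T}) :
  A :|: B = [set: I] ->
  #|[set g : {ffun I -> T} | (g @: A \subset J) && (g @: B \subset K)]| =
  (#|J| ^ #|A :\: B| * #|K| ^ #|B :\: A| * #|J :&: K| ^ #|A :&: B|)%N.
Proof.
move=> AB.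
pose F (i : I) : {set T} :=
  if i \in A then (if i \in B then J :&: K else J) else K.
have -> : #|[set g : {ffun I -> T} | (g @: A \subset J) && (g @: B \subset K)]| =
    #|family F|.
  apply: eq_card => g; rewrite inE.
  apply/andP/familyP => [[/subsetP gA /subsetP gB] i|gF].
    have : i \in A :|: B by rewrite AB inE.
    rewrite inE /F; case: (boolP (i \in A)) => iA; case: (boolP (i \in B)) => iB //= _.
    - by rewrite inE gA ?gB// imset_f.
    - by rewrite gA ?imset_f.
    - by rewrite gB ?imset_f.
  split; apply/subsetP => _ /imsetP[i iA ->]; have := gF i; rewrite /F iA.
    by case: ifP => // _; rewrite inE => /andP[].
  by case: ifP => // _; rewrite inE => /andP[].
rewrite card_family foldrE big_map big_enum /=.
rewrite (bigID [in A :\: B]) /= (bigID [in B :\: A] [predC (A :\: B)]) /=.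
rewrite -mulnA; congr (_ * (_ * _))%N.
- rewrite -[RHS]prod_nat_const; apply: eq_bigr => i.
  by rewrite inE /F => /andP[/negPf -> ->].
- rewrite -[RHS]prod_nat_const; apply: eq_big => i.
    by rewrite !inE; case: (i \in A); case: (i \in B).
  by rewrite !inE /F => /andP[_ /andP[/negPf -> _]].
- rewrite -[RHS]prod_nat_const; apply: eq_big => i.
    have : i \in A :|: B by rewrite AB inE.
    by rewrite !inE; case: (i \in A); case: (i \in B).
  have : i \in A :|: B by rewrite AB inE.
  by rewrite !inE /F; case: (i \in A); case: (i \in B).
Qed.

(** Both indicators are expanded by [in_arcE]; for each pair of arcs the maps are counted by a
    product. The sum over the second base point is [sum_card_arcI], the signs produce the
    differences of powers, and the first base point contributes the factor [N.+1]. Since [A] and [B]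
    meet, both images are nonempty and the exponent of the overlap is positive. *)
Lemma card_in_arc_pair (R : comPzRingType) (N l : nat) (I : finType) (A B : {set I}) :
  (2 * l.+1 <= N.+1)%N -> A :|: B = [set: I] -> A :&: B != set0 ->
  #|[set g : {ffun I -> 'I_N.+1} |
      in_arc l.+1 (g @: A) && in_arc l.+1 (g @: B)]|%:R =
  N.+1%:R * (l.+1%:R ^+ #|I| - l%:R ^+ #|I| + 2 * (sum_pow #|A :&: B| l.+1)%:R *
    (l.+1%:R ^+ #|A :\: B| - l%:R ^+ #|A :\: B|) *
    (l.+1%:R ^+ #|B :\: A| - l%:R ^+ #|B :\: A|)) :> R.
Proof.
move=> lN AB AB0.
have [i0 /setIP[i0A i0B]] := set0Pn _ AB0.
have k0 : (0 < #|A :&: B|)%N by rewrite card_gt0.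
set p := #|A :\: B|; set q := #|B :\: A|; set k := #|A :&: B|.
have cI : #|I| = (p + q + k)%N.
  rewrite -cardsT -AB -(cardsID B) setIUl setIid (setUidPr (subsetIr _ _)).
  rewrite setDUl setDv setU0 -(cardsID A B) -/p.
  by rewrite /k /q setIC; lia.
rewrite -sum1_card natr_sum big_mkcond /=.
transitivity (\sum_(g : {ffun I -> 'I_N.+1})
    (\sum_y \sum_(s < 2) (-1) ^+ s * (g @: A \subset arc s l.+1 y)%:R) *
    (\sum_z \sum_(t < 2) (-1) ^+ t * (g @: B \subset arc t l.+1 z)%:R) : R).
  apply: eq_bigr => g _; rewrite -!in_arcE// ?inE; last first.
  - by apply/set0Pn; exists (g i0); rewrite imset_f.
  - by apply/set0Pn; exists (g i0); rewrite imset_f.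
  by case: in_arc; case: in_arc; rewrite /= ?(mulr0, mul0r, mulr1).
transitivity (\sum_(y : 'I_N.+1) \sum_(s < 2) \sum_(t < 2) (-1) ^+ s * (-1) ^+ t *
   ((l.+1 - s) ^ p * (l.+1 - t) ^ q)%:R *
   (\sum_z #|arc s l.+1 y :&: arc t l.+1 z| ^ k)%:R : R).
  under eq_bigr do rewrite big_distrl /=.
  rewrite exchange_big; apply: eq_bigr => y _ /=.
  under eq_bigr do rewrite big_distrl /=.
  rewrite exchange_big; apply: eq_bigr => s _ /=.
  under eq_bigr do rewrite exchange_big big_distrr /=.
  rewrite exchange_big; apply: eq_bigr => t _ /=.
  under eq_bigr do rewrite big_distrr /=.
  rewrite exchange_big natr_sum big_distrr; apply: eq_bigr => z _ /=.
  transitivity ((-1) ^+ s * (-1) ^+ t *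
     (#|[set g : {ffun I -> 'I_N.+1} | (g @: A \subset arc s l.+1 y) &&
        (g @: B \subset arc t l.+1 z)]|)%:R : R).
    rewrite -sum1_card natr_sum [in RHS]big_mkcond big_distrr /=.
    apply: eq_bigr => g _; rewrite inE.
    by case: (_ \subset _); case: (_ \subset _); rewrite /= ?(mulr0, mul0r, mulr1).
  by rewrite card_ffun_imset_sub2// !card_arc// natrM mulrA.
transitivity (\sum_(y : 'I_N.+1) (l.+1%:R ^+ #|I| - l%:R ^+ #|I| + 2 * (sum_pow #|A :&: B| l.+1)%:R *
    (l.+1%:R ^+ #|A :\: B| - l%:R ^+ #|A :\: B|) *
    (l.+1%:R ^+ #|B :\: A| - l%:R ^+ #|B :\: A|)) : R); last first.
  by rewrite sumr_const card_ord [RHS]mulr_natl.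
apply: eq_bigr => y _.
have S s t : (s <= 1)%N -> (t <= 1)%N ->
    (\sum_z #|arc s l.+1 y :&: arc t l.+1 z| ^ k)%:R =
   2 * (sum_pow k l.+1)%:R + ((1 - s) * (1 - t) * l.+1 ^ k)%:R - (s * t * l ^ k)%:R :> R.
  move=> s1 t1; apply/eqP; rewrite -subr_eq opprK -natrD -natrM -natrD.
  by rewrite sum_card_arcI// eqxx.
under eq_bigr => s _ do
  under eq_bigr => t _ do rewrite (S _ _ (ltn_ord s) (ltn_ord t)).
rewrite !big_ord_recl !big_ord0 /= /bump /=.
rewrite -/p -/q -/k cI !subn0 !subnn !mul0n !mul1n !addr0 !expr0 !expr1.
rewrite subSS subn0 !natrM !natrX !exprD /= .
ring.
Qed.

End PairCount.
(** * Pairs of sets with a given union *)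

Section SetPairs.
Import mathcomp.boot.fintype mathcomp.boot.finset.
Local Open Scope set_scope.

Lemma card_inj_ffun_imset (I C : finType) (U : {set C}) :
  #|[set f : {ffun I -> C} | injectiveb f && (f @: [set: I] == U)]| =
  (if #|U| == #|I| then (#|I|)`! else 0)%N.
Proof.
case: eqP => UI; last first.
  apply/eqP; rewrite cards_eq0 -subset0; apply/subsetP => f; rewrite !inE.
  by move=> /andP[/injectiveP fI /eqP Uf]; case: UI; rewrite -Uf card_imset// cardsT.
rewrite -ffactnn -[X in (X ^_ _)%N]UI -card_inj_ffuns_on.
apply: eq_card => f; rewrite !inE andbC; case: injectiveP => fI; rewrite ?andbF//= !andbT.
have -> : (f @: [set: I] == U) = (f @: [set: I] \subset U).
  by rewrite eqEcard card_imset// UI cardsT leqnn andbT.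
apply/subsetP/ffun_onP => [h i|h _ /imsetP[i _ ->]]; last exact: h.
by rewrite h// imset_f.
Qed.

(* A bijection from ['I_n] onto [S :|: T] can be chosen in [n`!] ways. *)
Lemma sum_set_pairs (R : numFieldType) (C : finType) (n : nat)
    (F : {set C} -> {set C} -> R) :
  \sum_(ST : {set C} * {set C} | #|ST.1 :|: ST.2| == n) F ST.1 ST.2 =
  (n`!)%:R^-1 * \sum_(AB : {set 'I_n} * {set 'I_n} | AB.1 :|: AB.2 == [set: 'I_n])
     \sum_(f : {ffun 'I_n -> C} | injectiveb f) F (f @: AB.1) (f @: AB.2).
Proof.
rewrite exchange_big /=.
transitivity ((n`!)%:R^-1 * \sum_(f : {ffun 'I_n -> C} | injectiveb f)
    \sum_(ST : {set C} * {set C} | f @: [set: 'I_n] == ST.1 :|: ST.2) F ST.1 ST.2).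
  rewrite (exchange_big_dep xpredT) //= big_distrr /= big_mkcond /=.
  apply: eq_bigr => -[S T] _ /=; rewrite sumr_const.
  have := @card_inj_ffun_imset 'I_n C (S :|: T); rewrite card_ord cardE -cardE => cE.
  have -> : #|[pred f : {ffun 'I_n -> C} | injectiveb f & f @: [set: 'I_n] == S :|: T]| =
      (if #|S :|: T| == n then n`! else 0)%N.
    by rewrite -cE; apply: eq_card => f; rewrite !inE.
  case: ifP => _; last by rewrite mulr0n mulr0.
  by rewrite -[F S T *+ _]mulr_natl mulKf// pnatr_eq0 -lt0n fact_gt0.
congr (_ * _); apply: eq_bigr => f /injectiveP fI.
rewrite (reindex_onto (fun AB : {set 'I_n} * {set 'I_n} => (f @: AB.1, f @: AB.2))
   (fun ST => (f @^-1: ST.1, f @^-1: ST.2))) /=.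
  apply: eq_big => -[A B] //=.
  have fK (D : {set 'I_n}) : f @^-1: (f @: D) = D.
    by apply/setP => i; rewrite inE mem_imset.
  by rewrite !fK eqxx andbT -imsetU (inj_eq (imset_inj fI)) eq_sym.
move=> [S T] /= /eqP fU.
have fK (D : {set C}) : D \subset f @: [set: 'I_n] -> f @: (f @^-1: D) = D.
  move=> /subsetP Df; apply/setP => c; apply/imsetP/idP => [[i]|cD].
    by rewrite inE => ? ->.
  by have /imsetP[i _ ci] := Df _ cD; exists i; rewrite // inE -ci.
by rewrite !fK // fU ?subsetUl ?subsetUr.
Qed.

(** Exchanging the two arguments of [f] makes the coordinates independent; hence counts in dimension
    d are d-th powers of counts on the circle. *)
Lemma card_ffun_coord (I D X : finType) (Q : pred {ffun I -> X}) :
  #|[set f : {ffun I -> {ffun D -> X}} | [forall c, Q [ffun i => f i c]]]| =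
  (#|[set g | Q g]| ^ #|D|)%N.
Proof.
pose sw (f : {ffun I -> {ffun D -> X}}) : {ffun D -> {ffun I -> X}} :=
  [ffun c => [ffun i => f i c]].
pose ws (f : {ffun D -> {ffun I -> X}}) : {ffun I -> {ffun D -> X}} :=
  [ffun i => [ffun c => f c i]].
have swK : cancel sw ws by move=> f; apply/ffunP => i; apply/ffunP => c; rewrite !ffunE.
have wsK : cancel ws sw by move=> f; apply/ffunP => i; apply/ffunP => c; rewrite !ffunE.
rewrite -card_ffun_on -(card_imset _ (can_inj swK)).
apply: eq_card => g; apply/imsetP/ffun_onP => [[f]|gQ].
  by rewrite inE => /forallP fQ -> c; rewrite inE ffunE.
exists (ws g); rewrite ?wsK// inE; apply/forallP => c.
have := gQ c; rewrite inE; congr (Q _).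
by apply/ffunP => i; rewrite !ffunE.
Qed.

(** The non-injective maps satisfying [Q] are at most all the non-injective maps; this bounds from
    below what the restriction to injections leaves. *)
Lemma card_inj_ffun_ge (I C : finType) (Q : pred {ffun I -> C}) :
  (#|[set f | Q f]| + #|C| ^_ #|I| <=
   #|[set f : {ffun I -> C} | injectiveb f && Q f]| + #|C| ^ #|I|)%N.
Proof.
have <- : #|{ffun I -> C}| = (#|C| ^ #|I|)%N by rewrite card_ffun.
rewrite -card_inj_ffuns.
rewrite -(cardsID [set f : {ffun I -> C} | injectiveb f] [set f | Q f]).
have -> : [set f | Q f] :&: [set f : {ffun I -> C} | injectiveb f] =
    [set f : {ffun I -> C} | injectiveb f && Q f].
  by apply/setP => f; rewrite !inE andbC.
rewrite -addnA leq_add2l -cardsT -(cardsID [set f : {ffun I -> C} | injectiveb f] setT).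
rewrite setTI addnC leq_add2l; apply: subset_leq_card; apply/subsetP => f.
by rewrite !inE => /andP[-> _].
Qed.

End SetPairs.
(** * Asymptotics of the counts *)

Section Limits.
Context {R : realType}.

Lemma cvgn_sum (I : Type) (r : seq I) (Q : pred I) (u : I -> nat -> R) (v : I -> R) :
  (forall i, Q i -> u i n @[n --> \oo] --> v i) ->
  \sum_(i <- r | Q i) u i n @[n --> \oo] --> \sum_(i <- r | Q i) v i.
Proof.
move=> uv; elim: r => [|i r IH].
  under eq_fun do rewrite big_nil.
  by rewrite big_nil; exact: cvg_cst.
under eq_fun do rewrite big_cons.
rewrite big_cons; case: ifP => // Qi.
by apply: cvgD => //; exact: uv.
Qed.

Lemma cvgn_exp (u : nat -> R) (x : R) (k : nat) :
  u n @[n --> \oo] --> x -> u n ^+ k @[n --> \oo] --> x ^+ k.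
Proof.
move=> ux; elim: k => [|k IH].
  under eq_fun do rewrite expr0.
  by rewrite expr0; exact: cvg_cst.
under eq_fun do rewrite exprS.
by rewrite exprS; apply: cvgM.
Qed.

Lemma cvgn_inv_succ : (n.+1%:R^-1 : R) @[n --> \oo] --> (0 : R).
Proof. exact: cvg_harmonic. Qed.

Context {l : nat -> nat} {r : R}.
Hypothesis lr : (l n)%:R / n.+1%:R @[n --> \oo] --> r.

Lemma cvgn_succ_ratio : (l n).+1%:R / n.+1%:R @[n --> \oo] --> r.
Proof.
under eq_fun do rewrite -[(l _).+1]addn1 natrD mulrDl mul1r.
by rewrite -[r]addr0; apply: cvgD => //; exact: cvgn_inv_succ.
Qed.

(** The two ratios differ by 1/(n + 1) and both tend to [r], so this is a difference quotient of x^p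
    and its limit is the derivative at [r]. *)
Lemma cvgn_diff_pow (p : nat) :
  n.+1%:R * (((l n).+1%:R / n.+1%:R) ^+ p - ((l n)%:R / n.+1%:R) ^+ p)
    @[n --> \oo] --> p%:R * r ^+ p.-1.
Proof.
have -> : p%:R * r ^+ p.-1 = \sum_(i < p) r ^+ (p.-1 - i) * r ^+ i.
  rewrite -[X in X%:R](card_ord p) -sumr_const big_distrl /=; apply: eq_bigr => i _.
  by rewrite mul1r -exprD subnK//; have := ltn_ord i; lia.
suff -> : (fun n => n.+1%:R * (((l n).+1%:R / n.+1%:R) ^+ p - ((l n)%:R / n.+1%:R) ^+ p)) =
    (fun n => \sum_(i < p) ((l n).+1%:R / n.+1%:R) ^+ (p.-1 - i) *
       ((l n)%:R / n.+1%:R) ^+ i) :> (nat -> R).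
  apply: cvgn_sum => i _; apply: cvgM; apply: cvgn_exp => //.
  exact: cvgn_succ_ratio.
apply/funext => n; rewrite subrXX.
have -> : (l n).+1%:R / n.+1%:R - (l n)%:R / n.+1%:R = n.+1%:R^-1 :> R.
  by rewrite -[(l n).+1]addn1 natrD; field.
rewrite mulrA divff ?mul1r ?pnatr_eq0//.
Qed.

(** Discrete comparison with the integral of x^k: each increment of b^(k + 1) lies between (k + 1)
    b^k and (k + 1) (b + 1)^k, and the increments telescope. *)
Lemma sum_pow_bounds (k m : nat) :
  (k.+1 * sum_pow k m <= m ^ k.+1 <= k.+1 * sum_pow k m.+1)%N.
Proof.
have D b : (k.+1 * b ^ k <= b.+1 ^ k.+1 - b ^ k.+1 <= k.+1 * b.+1 ^ k)%N.
  have E x : (k.+1 * x = \sum_(i < k.+1) x)%N by rewrite sum_nat_const card_ord.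
  have mon e : (b ^ e <= b.+1 ^ e)%N by case: e => // e; rewrite leq_exp2r.
  rewrite subn_exp subSnn mul1n !E; apply/andP; split; apply: leq_sum => i _ /=.
    by rewrite -[leqLHS](congr1 (expn b) (subnK (leq_ord i))) expnD leq_mul.
  by rewrite -[leqRHS](congr1 (expn b.+1) (subnK (leq_ord i))) expnD leq_mul.
have Dle b : (b ^ k.+1 <= b.+1 ^ k.+1)%N by rewrite leq_exp2r.
have S0 : sum_pow k 0 = 0%N by rewrite /sum_pow big_ord0.
have SS j : sum_pow k j.+1 = (sum_pow k j + j ^ k)%N by rewrite /sum_pow big_ord_recr.
elim: m => [|m IH]; first by rewrite S0 muln0 exp0n.
have := D m; have := Dle m; move: IH; rewrite (SS m.+1) SS; lia.
Qed.

Lemma cvgn_sum_pow (k : nat) :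
  (sum_pow k (l n).+1)%:R / n.+1%:R ^+ k.+1 @[n --> \oo] --> r ^+ k.+1 / k.+1%:R.
Proof.
have lo : ((l n)%:R / n.+1%:R) ^+ k.+1 / k.+1%:R @[n --> \oo] --> r ^+ k.+1 / k.+1%:R.
  by apply: cvgMr_tmp; exact: cvgn_exp.
have hi : ((l n).+1%:R / n.+1%:R) ^+ k.+1 / k.+1%:R @[n --> \oo] --> r ^+ k.+1 / k.+1%:R.
  by apply: cvgMr_tmp; apply: cvgn_exp; exact: cvgn_succ_ratio.
apply: (squeeze_cvgr _ lo hi); apply: nearW => n.
rewrite !expr_div_n ![_ / _ / k.+1%:R]mulrAC !ler_pM2r ?invr_gt0 ?exprn_gt0//.
rewrite ler_pdivrMr// ler_pdivlMr// -!natrX -!natrM !ler_nat ![(_ * k.+1)%N]mulnC.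
have /andP[_ ->] := sum_pow_bounds k (l n).
by have /andP[-> _] := sum_pow_bounds k (l n).+1.
Qed.

Hypothesis r_half : r < 2^-1.

Lemma near_arc_half : \forall n \near \oo, (2 * (l n).+1 <= n.+1)%N.
Proof.
apply: (filterS _ (cvgr_lt _ cvgn_succ_ratio _ r_half)) => n /=.
by rewrite ltr_pdivrMr// ltr_pdivlMl// -natrM ltr_nat => /ltnW.
Qed.

(** After division by the power of n + 1, the closed form of [card_in_arc_pair] splits into rescaled
    factors [D] (derivatives in the limit) and [S] (an integral in the limit). *)
Lemma cvgn_card_in_arc_pair (I : finType) (A B : {set I}) :
  (A :|: B = [set: I])%SET -> (A :&: B)%SET != finset.set0 ->
  #|[set g : {ffun I -> 'I_n.+1} |
      in_arc (l n).+1 (g @: A)%SET && in_arc (l n).+1 (g @: B)%SET]%SET|%:R / n.+1%:R ^+ #|I|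
    @[n --> \oo] -->
  r ^+ #|I|.-1 * (#|I|%:R + 2 * (#|(A :\: B)%SET| * #|(B :\: A)%SET|)%:R /
                            #|(A :&: B)%SET|.+1%:R).
Proof.
move=> AB AB0; set p := #|_|; set q := #|_|; set k := #|_|.
have cI : #|I| = (p + q + k)%N.
  rewrite -cardsT -AB -(cardsID B) finset.setIUl finset.setIid (finset.setUidPr (finset.subsetIr _ _)).
  rewrite finset.setDUl finset.setDv finset.setU0 -(cardsID A B) -/p.
  by rewrite /k /q finset.setIC; lia.
have -> : r ^+ #|I|.-1 * (#|I|%:R + 2 * (p * q)%:R / k.+1%:R) =
    #|I|%:R * r ^+ #|I|.-1 +
    2 * (r ^+ k.+1 / k.+1%:R) * (p%:R * r ^+ p.-1) * (q%:R * r ^+ q.-1).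
  rewrite mulrDr [_ * #|I|%:R]mulrC; congr (_ + _); rewrite cI natrM.
  (* If [p] or [q] is 0 both sides vanish, so the truncated predecessor in the exponent does no
     harm. *)
  case: (p) => [|p']; first by rewrite !(mul0r, mulr0).
  case: (q) => [|q']; first by rewrite !(mul0r, mulr0).
  have -> : (p'.+1 + q'.+1 + k).-1 = (k.+1 + p' + q')%N by lia.
  by rewrite /= !exprD; ring.
pose D p n : R :=
  n.+1%:R * (((l n).+1%:R / n.+1%:R) ^+ p - ((l n)%:R / n.+1%:R) ^+ p).
pose S n : R := (sum_pow k (l n).+1)%:R / n.+1%:R ^+ k.+1.
have : D #|I| n + 2 * S n * D p n * D q n @[n --> \oo] -->
    #|I|%:R * r ^+ #|I|.-1 +
    2 * (r ^+ k.+1 / k.+1%:R) * (p%:R * r ^+ p.-1) * (q%:R * r ^+ q.-1).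
  apply: cvgD; first exact: cvgn_diff_pow.
  apply: cvgM; last exact: cvgn_diff_pow.
  apply: cvgM; last exact: cvgn_diff_pow.
  by apply: cvgMl_tmp; exact: cvgn_sum_pow.
apply: cvg_trans.
apply: near_eq_cvg; apply: (filterS _ near_arc_half) => n ln /=.
rewrite (card_in_arc_pair R _ _ _ _ _ ln AB AB0) -/p -/q -/k /D /S cI !expr_div_n.
have n0 : n.+1%:R != 0 :> R by rewrite pnatr_eq0.
set M := n.+1%:R in n0 *; set L := (l n).+1%:R; set l' := (l n)%:R; set S' := (sum_pow k _)%:R.
rewrite exprS !exprD.
have := expf_neq0 p n0; have := expf_neq0 q n0; have := expf_neq0 k n0.
set Mp := M ^+ p; set Mq := M ^+ q; set Mk := M ^+ k; move=> k0 q0 p0.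
move: L l' S' => L l' S'; clearbody Mp Mq Mk M; field; by rewrite ?n0 ?k0 ?q0 ?p0.
Qed.

End Limits.

(** * Covering pairs and the coefficients of the series *)

Section VarCoef.
Import mathcomp.boot.fintype mathcomp.boot.finset.
Local Open Scope set_scope.

(** A multinomial coefficient: once [A] is chosen, [B] must contain its complement and is determined
    by [A :&: B], any subset of [A] with i + j - n elements. *)
Lemma card_cover_pairs (I : finType) (i j : nat) :
  (i <= #|I|)%N -> (j <= #|I|)%N -> (#|I| <= i + j)%N ->
  (#|[set AB : {set I} * {set I} |
      [&& AB.1 :|: AB.2 == [set: I], #|AB.1| == i & #|AB.2| == j]]| *
   ((#|I| - j)`! * (#|I| - i)`! * (i + j - #|I|)`!) = (#|I|)`!)%N.
Proof.
move cn : #|I| => n iI jI ijI.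
have -> : #|[set AB : {set I} * {set I} |
      [&& AB.1 :|: AB.2 == [set: I], #|AB.1| == i & #|AB.2| == j]]| =
    (\sum_(A : {set I} | #|A| == i) 'C(i, i + j - n))%N.
  rewrite -sum1_card.
  rewrite (eq_bigl (fun AB : {set I} * {set I} => (#|AB.1| == i) &&
      ((AB.1 :|: AB.2 == [set: I]) && (#|AB.2| == j)))); last first.
    by move=> AB; rewrite inE; do ! case: (_ == _).
  rewrite -(pair_big_dep (fun A : {set I} => #|A| == i)
    (fun A B => (A :|: B == [set: I]) && (#|B| == j)) (fun _ _ => 1%N)) /=.
  apply: eq_bigr => A /eqP Ai; rewrite -[X in 'C(X, _)]Ai -cards_draws sum1_card.
  have AB (B : {set I}) : A :|: B == [set: I] -> B = (~: A) :|: (A :&: B).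
    move=> /eqP AB; apply/setP => x; have := in_setT x; rewrite -AB !inE.
    by case: (x \in A).
  have dis (D : {set I}) : D \subset A -> #|~: A :|: D| = (n - i + #|D|)%N.
    move=> DA; rewrite cardsU [~: A :&: D](_ : _ = set0) ?cards0 ?subn0.
      by rewrite [#|~: A|]cardsCs setCK Ai cn.
    by apply/eqP; rewrite setIC setI_eq0 disjoints_subset setCK.
  rewrite -(card_in_imset (f := fun D => ~: A :|: D)
     (D := [set D : {set I} | (D \subset A) & (#|D| == (i + j - n)%N)])).
    rewrite -[#|[set _ | _ in _]|]sum1_card -[LHS]sum1_card.
    apply: eq_bigl => B; apply/andP/imsetP => [[/AB eB /eqP Bj]|[D]].
      exists (A :&: B); rewrite // inE subsetIl /=; apply/eqP.
      have cB := dis _ (subsetIl A B); rewrite -eB Bj in cB.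
      lia.
    rewrite inE => /andP[DA /eqP Dij] ->; split.
      by rewrite setUA setUCr setTU.
    by rewrite dis// Dij; apply/eqP; lia.
  move=> D1 D2; rewrite !inE => /andP[D1A _] /andP[D2A _] e.
  apply/setP => x; have := congr1 (fun Z : {set I} => (x \in Z) && (x \in A)) e.
  rewrite !inE; have [xA|xA] := boolP (x \in A); first by rewrite /= !andbT.
  by rewrite (contraNF (subsetP D1A x) xA) (contraNF (subsetP D2A x) xA).
rewrite sum_nat_const (_ : #|_| = 'C(n, i)); last first.
  by rewrite -cn -card_draws; apply: eq_card => A; rewrite inE.
rewrite -(bin_fact iI) -(bin_fact (_ : i + j - n <= i)%N); last lia.
have -> : (i - (i + j - n) = n - j)%N by lia.
lia.
Qed.

(** Pairs are grouped by their sizes (i, j). For a covering pair, |A :&: B| = i + j - n, so meeting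
    amounts to n < i + j. *)
Lemma sum_cover_pairs (R : numFieldType) (n : nat) (G : nat -> nat -> R) :
  (n`!)%:R^-1 * \sum_(AB : {set 'I_n} * {set 'I_n} |
      (AB.1 :|: AB.2 == [set: 'I_n]) && (AB.1 :&: AB.2 != set0)) G #|AB.1| #|AB.2| =
  \sum_(j < n.+1) \sum_(i < n.+1 | (n < i + j)%N)
     G i j / ((n - j)`! * (n - i)`! * (i + j - n)`!)%:R.
Proof.
have cI (AB : {set 'I_n} * {set 'I_n}) : AB.1 :|: AB.2 == [set: 'I_n] ->
    (#|AB.1| + #|AB.2| = n + #|AB.1 :&: AB.2|)%N.
  by move=> /eqP e; rewrite -cardsUI e cardsT card_ord.
have bnd (A : {set 'I_n}) : (#|A| < n.+1)%N.
  by rewrite ltnS -[leqRHS](card_ord n) max_card.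
have oE A (k : 'I_n.+1) : (Ordinal (bnd A) == k) = (#|A| == k) by [].
rewrite (partition_big (fun AB : {set 'I_n} * {set 'I_n} => Ordinal (bnd AB.2)) xpredT) //=.
rewrite big_distrr; apply: eq_bigr => j _ /=.
rewrite (partition_big (fun AB : {set 'I_n} * {set 'I_n} => Ordinal (bnd AB.1))
   (fun i : 'I_n.+1 => (n < i + j)%N)) /=; last first.
  move=> AB /andP[/andP[e AB0] /eqP <-] /=.
  by rewrite cI//; move: AB0; rewrite -card_gt0; lia.
rewrite big_distrr; apply: eq_bigr => i nij /=.
have := @card_cover_pairs 'I_n i j; rewrite card_ord => /(_ (leq_ord i) (leq_ord j)).
set c := #|_|; set m := (_ * _ * _)%N => H.
have {}H : (c * m)%N = n`! by apply: H; lia.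
rewrite (eq_bigr (fun=> G i j)); last by move=> AB /andP[/andP[_ /eqP <-] /eqP <-].
have -> : \sum_(AB : {set 'I_n} * {set 'I_n} | (AB.1 :|: AB.2 == [set: 'I_n]) && (AB.1 :&: AB.2 != set0) &&
       (Ordinal (bnd AB.2) == j) && (Ordinal (bnd AB.1) == i)) G i j = G i j *+ c.
  rewrite sumr_const; congr (_ *+ _); apply: eq_card => AB; rewrite inE [in LHS]unfold_in /= !oE.
  have [e|] /= := boolP (AB.1 :|: AB.2 == [set: 'I_n]); last by rewrite ?andbF.
  have := cI _ e; have [/eqP->|] := boolP (#|AB.1| == i); rewrite ?andbF//.
  have [/eqP->|] := boolP (#|AB.2| == j); rewrite ?andbF// ?andbT => ij.
  by rewrite -card_gt0; apply/esym; lia.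
have m0 : m%:R != 0 :> R by rewrite pnatr_eq0 -lt0n !muln_gt0 !fact_gt0.
have c0 : c%:R != 0 :> R.
  by rewrite pnatr_eq0; apply/eqP => c0; move: (fact_gt0 n); rewrite -H c0.
by rewrite -H natrM -mulr_natr; field; rewrite c0 m0.
Qed.

(** By symmetry the sum is twice the part i <= j minus the diagonal. There n < i + j <= 2 j, which
    forces j to be at least the ceiling of (n + 1) / 2. *)
Lemma sum_sym_pairs (R : pzRingType) (n : nat) (g : nat -> nat -> R) :
  (forall i j, g i j = g j i) ->
  \sum_(j < n.+1) \sum_(i < n.+1 | (n < i + j)%N) g i j =
  \sum_(uphalf n.+1 <= j < n.+1) (2 * (\sum_(n - j + 1 <= i < j.+1) g i j) - g j j).
Proof.
move=> gC.
pose lower := \sum_(j < n.+1) \sum_(i < n.+1 | (n < i + j)%N && (i <= j)%N) g i j.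
pose diag := \sum_(j < n.+1 | (n < j + j)%N) g j j.
have upper : \sum_(j < n.+1) \sum_(i < n.+1 | (n < i + j)%N && ~~ (i <= j)%N) g i j = lower - diag.
  apply/eqP; rewrite eq_sym subr_eq; apply/eqP; rewrite /lower.
  transitivity (\sum_(j < n.+1) (\sum_(i < n.+1 | (n < i + j)%N && (i < j)%N) g i j +
      if (n < j + j)%N then g j j else 0)).
    apply: eq_bigr => j _; rewrite (bigID (fun i : 'I_n.+1 => i == j)) /= addrC.
    congr (_ + _).
      by apply: eq_bigl => i; rewrite -[i == j]val_eqE /=; lia.
    rewrite (eq_bigl (fun i => (i == j) && (n < j + j)%N)); last first.
      by move=> i; case: eqP => [->|]; rewrite ?andbF// leqnn !andbT.
    by rewrite big_mkcondr big_pred1_eq.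
  rewrite big_split /= -big_mkcond; congr (_ + _).
  rewrite (exchange_big_dep xpredT) //=; apply: eq_bigr => j _.
  by apply: eq_big => [i|i _]; [rewrite -ltnNge addnC|exact: gC].
transitivity (lower + lower - diag).
  rewrite -addrA -upper /lower -big_split /=; apply: eq_bigr => j _.
  by rewrite (bigID (fun i : 'I_n.+1 => (i <= j)%N)).
have half (F : nat -> R) : (forall j, (2 * j <= n)%N -> F j = 0) ->
    \sum_(j < n.+1) F j = \sum_(uphalf n.+1 <= j < n.+1) F j.
  move=> F0; rewrite -(big_mkord xpredT F) (big_cat_nat (n := uphalf n.+1)) //=; last lia.
  by rewrite big_nat big1 ?add0r// => j jn; apply: F0; lia.
have -> : lower = \sum_(uphalf n.+1 <= j < n.+1) \sum_(n - j + 1 <= i < j.+1) g i j.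
  rewrite -half; last by move=> j jn; rewrite big_geq//; lia.
  apply: eq_bigr => j _; have jn := ltn_ord j.
  rewrite -(big_mkord (fun i => (n < i + j)%N && (i <= j)%N) (fun i => g i j)).
  rewrite [RHS](big_nat_widenl _ 0)// [RHS](big_nat_widen _ _ n.+1)//.
  by apply: eq_bigl => i; lia.
have -> : diag = \sum_(uphalf n.+1 <= j < n.+1) g j j.
  rewrite /diag big_mkcond (half (fun j => if (n < j + j)%N then g j j else 0)).
    by rewrite big_nat [RHS]big_nat; apply: eq_bigr => j jn; rewrite ifT//; lia.
  by move=> j jn; rewrite ifF//; lia.
by rewrite sumrB -big_distrr /= mulr_natl mulr2n.
Qed.

(* [var_coef] is the sum over the pairs (A, B) covering ['I_n], up to n`!,
   symmetrised in (|A|, |B|). *)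
Lemma var_coefE (R : realType) (d n : nat) :
  (n`!)%:R^-1 * \sum_(AB : {set 'I_n} * {set 'I_n} |
      (AB.1 :|: AB.2 == [set: 'I_n]) && (AB.1 :&: AB.2 != set0))
      (-1) ^+ (#|AB.1| + #|AB.2|) *
      (n%:R + 2 * (#|AB.1 :\: AB.2| * #|AB.2 :\: AB.1|)%:R /
              #|AB.1 :&: AB.2|.+1%:R) ^+ d = var_coef R d n.
Proof.
pose G i j : R := (-1) ^+ (i + j) *
  (n%:R + (2 * (n - i) * (n - j))%:R / (1 + i + j - n)%:R) ^+ d.
transitivity ((n`!)%:R^-1 * \sum_(AB : {set 'I_n} * {set 'I_n} |
      (AB.1 :|: AB.2 == [set: 'I_n]) && (AB.1 :&: AB.2 != set0)) G #|AB.1| #|AB.2|).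
  congr (_ * _); apply: eq_bigr => -[A B] /= /andP[/eqP AB _].
  have cU : (#|A| + #|B| = n + #|A :&: B|)%N by rewrite -cardsUI AB cardsT card_ord.
  have cA := cardsID B A; have cB := cardsID A B; rewrite setIC in cB.
  rewrite /G (_ : #|A :\: B| = n - #|B|)%N; last lia.
  rewrite (_ : #|B :\: A| = n - #|A|)%N; last lia.
  rewrite (_ : 1 + #|A| + #|B| - n = #|A :&: B|.+1)%N; last lia.
  by rewrite -mulnA [((n - #|A|) * _)%N]mulnC -natrM.
rewrite sum_cover_pairs.
pose g i j : R := G i j / ((n - j)`! * (n - i)`! * (i + j - n)`!)%:R.
rewrite (sum_sym_pairs R n g); last first.
  move=> i j; rewrite /g /G [(j + i)%N]addnC [((n - i)`! * _)%N]mulnC.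
  by rewrite -(addnA 1 i j) -(addnA 1 j i) [(j + i)%N]addnC -!mulnA [((n - i) * _)%N]mulnC.
rewrite /var_coef big_nat [RHS]big_nat; apply: eq_bigr => j jn.
congr (2 * _ - _).
  by apply: eq_bigr => i _; rewrite /g /G; ring.
rewrite /g /G addnn -mul2n exprM sqrrN expr1n expr1n mul1r.
rewrite -(addnA 1 j j) addnn -mul2n mulrC -mulnA -!mulnn.
by rewrite div1r [(2 * (_ * _))%N]mulnA.
Qed.

End VarCoef.
(** * The variance of the discrete Euler characteristic *)

Section FiniteModel.
Import mathcomp.boot.fintype mathcomp.boot.finset.
Local Open Scope set_scope.
Context {R : realType}.

(** The exponent [#|S|.+1] has the parity of the dimension [#|S|] - 1 without truncation; the empty
    set is excluded from the simplices. *)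
Definition simplex_weight {C : finType} (h : pred {set C}) (S : {set C}) : R :=
  if S == set0 then 0 else (-1) ^+ #|S|.+1 * (h S)%:R.

(** The variance of the weighted number of occupied sets when points are occupied independently with
    probability [p]: the last factor is the covariance of the events that [S] and [T] are fully
    occupied. *)
Definition finite_variance {C : finType} (h : pred {set C}) (p : R) : R :=
  \sum_(ST : {set C} * {set C}) simplex_weight h ST.1 * simplex_weight h ST.2 *
     (p ^+ #|ST.1 :|: ST.2| - p ^+ (#|ST.1| + #|ST.2|)).

(** The contribution of the pairs whose union has [n] points, parametrised by injections of ['I_n].
    As |A| + |B| = n + |A :&: B|, the covariance factors as p^n (1 - p^|A :&: B|). *)
Definition variance_term {C : finType} (h : pred {set C}) (p : R) (n : nat) : R :=
  p ^+ n * ((n`!)%:R^-1 * \sum_(AB : {set 'I_n} * {set 'I_n} |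
      (AB.1 :|: AB.2 == [set: 'I_n]) && (AB.1 :&: AB.2 != set0))
    (-1) ^+ (#|AB.1| + #|AB.2|) * (1 - p ^+ #|AB.1 :&: AB.2|) *
    #|[set f : {ffun 'I_n -> C} | injectiveb f && (h (f @: AB.1) && h (f @: AB.2))]|%:R).

Lemma finite_varianceE (C : finType) (h : pred {set C}) (p : R) (K : nat) :
  (#|C| < K)%N -> finite_variance h p = \sum_(n < K) variance_term h p n.
Proof.
move=> CK; rewrite /finite_variance.
have bnd (ST : {set C} * {set C}) : (#|ST.1 :|: ST.2| < K)%N.
  by rewrite (leq_ltn_trans _ CK)// max_card.
rewrite (partition_big (fun ST => Ordinal (bnd ST)) xpredT) //=.
apply: eq_bigr => n _.
pose F S T := simplex_weight h S * simplex_weight h T *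
     (p ^+ #|S :|: T| - p ^+ (#|S| + #|T|)).
transitivity (\sum_(ST : {set C} * {set C} | #|ST.1 :|: ST.2| == n) F ST.1 ST.2).
  by apply: eq_bigl => ST.
rewrite sum_set_pairs /variance_term mulrCA; congr (_ * _).
rewrite big_distrr /= (bigID (fun AB : {set 'I_n} * {set 'I_n} => AB.1 :&: AB.2 != set0)) /=.
(* For disjoint [A] and [B] the two powers of [p] coincide, so the covariance is zero. *)
rewrite [X in _ + X]big1 ?addr0; last first.
  move=> [A B] /= /andP[_ /negbNE/eqP AB0]; apply: big1 => f /injectiveP fI.
  rewrite /F -imsetU !card_imset// cardsU AB0 cards0 subn0 subrr mulr0 //.
apply: eq_bigr => -[A B] /= /andP[/eqP AB AB0].
have cU : (#|A| + #|B| = n + #|A :&: B|)%N by rewrite -cardsUI AB cardsT card_ord.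
have [i /setIP[iA iB]] := set0Pn _ AB0.
transitivity (\sum_(f : {ffun 'I_n -> C} | injectiveb f && (h (f @: A) && h (f @: B)))
   (p ^+ n * ((-1) ^+ (#|A| + #|B|) * (1 - p ^+ #|A :&: B|)))); last first.
  rewrite [RHS]mulrA -[X in _ * X%:R]sum1_card natr_sum big_distrr /=.
  by apply: eq_big => f; rewrite ?inE ?mulr1.
rewrite [RHS]big_mkcondr; apply: eq_bigr => f /injectiveP fI.
rewrite /F -imsetU AB !card_imset// cardsT card_ord cU exprD /simplex_weight.
have fD0 (D : {set 'I_n}) : i \in D -> (f @: D == set0) = false.
  by move=> iD; apply/negbTE/set0Pn; exists (f i); rewrite imset_f.
rewrite !fD0// !card_imset// -cU exprD !exprS.
by case: (h _); case: (h _); rewrite /= ?(mulr0, mul0r)//; ring.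
Qed.

(** There are 4^n pairs (A, B), each with at most |C|^n maps, and 1 - p^k lies between 0 and 1. *)
Lemma variance_term_bound (C : finType) (h : pred {set C}) (p : R) (n : nat) :
  0 <= p <= 1 -> `|variance_term h p n| <= (4 * (p * #|C|%:R)) ^+ n / (n`!)%:R.
Proof.
move=> /andP[p0 p1]; rewrite /variance_term normrM (ger0_norm (exprn_ge0 _ p0)).
rewrite normrM ger0_norm ?invr_ge0// mulrCA [leRHS]mulrC ler_wpM2l ?invr_ge0//.
have -> : (4 * (p * #|C|%:R)) ^+ n = p ^+ n * (4 ^+ n * #|C|%:R ^+ n) by rewrite !exprMn; ring.
rewrite ler_wpM2l ?exprn_ge0//.
apply: (le_trans (ler_norm_sum _ _ _)).
apply: (@le_trans _ _ (\sum_(AB : {set 'I_n} * {set 'I_n}) #|C|%:R ^+ n)); last first.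
  have c2 : #|{set 'I_n}| = (2 ^ n)%N.
    by rewrite -[RHS](congr1 (expn 2) (card_ord n)) -[in RHS]cardsT -card_powerset powersetT cardsT.
  rewrite sumr_const card_prod c2 -[X in X <= _]mulr_natl.
  by rewrite -expnD addnn -mul2n expnM natrX.
rewrite big_mkcond /=; apply: ler_sum => -[A B] _ /=; case: ifP => _; last exact: exprn_ge0.
rewrite !normrM normrX normrN1 expr1n mul1r normr_nat.
rewrite -[leRHS]mul1r; apply: ler_pM => //.
  rewrite ger0_norm ?lerBlDr ?lerDl ?exprn_ge0//.
  by rewrite subr_ge0 exprn_ile1.
rewrite -natrX ler_nat -[X in (_ ^ X)%N](card_ord n) -card_ffun.
exact: max_card.
Qed.

End FiniteModel.

(** * The complex on the cells of a grid *)

Section GridModel.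
Import mathcomp.boot.fintype mathcomp.boot.finset.
Local Open Scope set_scope.
Context {d : nat}.

Definition cell (N : nat) := {ffun 'I_d -> 'I_N.+1}.

(** Balls of the sup distance are products, so the condition is imposed on each coordinate
    separately. *)
Definition cell_cech {N : nat} (L : nat) (S : {set cell N}) : bool :=
  [forall c, in_arc L [set (u : cell N) c | u in S]].

Lemma card_cell (N : nat) : #|cell N| = (N.+1 ^ d)%N.
Proof. by rewrite card_ffun !card_ord. Qed.

Lemma card_cell_cech_pair (I : finType) (A B : {set I}) (N L : nat) :
  #|[set f : {ffun I -> cell N} | cell_cech L (f @: A) && cell_cech L (f @: B)]| =
  (#|[set g : {ffun I -> 'I_N.+1} | in_arc L (g @: A) && in_arc L (g @: B)]| ^ d)%N.
Proof.
rewrite -[X in (_ ^ X)%N](card_ord d) -card_ffun_coord; apply: eq_card => f.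
have E (D : {set I}) c : [set [ffun i => f i c] i | i in D] =
    [set (u : cell N) c | u in f @: D].
  by rewrite -imset_comp; apply: eq_imset => i; rewrite ffunE.
rewrite !inE /cell_cech; apply/andP/forallP => [[/forallP fA /forallP fB] c|fAB].
  by rewrite !E fA fB.
by split; apply/forallP => c; rewrite -E; case/andP: (fAB c).
Qed.

End GridModel.

(** * Limits of the individual variance terms *)

Section GridLimits.
Context {R : realType}.

Lemma cvgn_ffact (m : nat -> nat) (k : nat) : (forall n, (0 < m n)%N) ->
  (m n)%:R^-1 @[n --> \oo] --> (0 : R) ->
  (m n ^_ k)%:R / (m n)%:R ^+ k @[n --> \oo] --> (1 : R).
Proof.
move=> m0 mV; elim: k => [|k IH].
  under eq_fun do rewrite ffactn0 expr0 divr1.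
  exact: cvg_cst.
have lo : 1 - k%:R * (m n)%:R^-1 @[n --> \oo] --> (1 : R).
  rewrite -[X in _ --> X]subr0 -[X in _ --> _ - X](mulr0 k%:R).
  by apply: cvgB; [exact: cvg_cst|apply: cvgMl_tmp].
have step : (m n - k)%:R / (m n)%:R @[n --> \oo] --> (1 : R).
  have hi : (fun=> 1 : R) n @[n --> \oo] --> (1 : R) by exact: cvg_cst.
  apply: (squeeze_cvgr _ lo hi).
  apply: nearW => n.
  have mn : 0 < (m n)%:R :> R by rewrite ltr0n.
  rewrite ler_pdivrMr// mul1r ler_nat leq_subr andbT ler_pdivlMr// mulrBl mul1r.
  by rewrite mulfVK ?gt_eqF// lerBlDr -natrD ler_nat; lia.
under eq_fun do rewrite ffactnSr natrM exprSr invfM mulrACA.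
have : ((m n ^_ k)%:R / (m n)%:R ^+ k) * ((m n - k)%:R / (m n)%:R) @[n --> \oo] --> (1 * 1 : R).
  exact: cvgM.
by rewrite mulr1.
Qed.

Context {l : nat -> nat} {r : R} {d : nat}.
Hypothesis lr : (l n)%:R / n.+1%:R @[n --> \oo] --> r.
Hypothesis r_half : r < 2^-1.
Hypothesis d0 : (0 < d)%N.

Lemma cvgn_inv_succ_exp : ((n.+1 ^ d)%N%:R^-1 : R) @[n --> \oo] --> (0 : R).
Proof.
under eq_fun do rewrite natrX -exprVn.
have -> : (0 : R) = 0 ^+ d by rewrite expr0n; case: d d0.
by apply: cvgn_exp; exact: cvgn_inv_succ.
Qed.

(** The upper bound counts all maps, injective or not. The lower bound subtracts all non-injective
    maps, whose proportion tends to 0 by [cvgn_ffact]. *)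
Lemma cvgn_card_inj_cell_cech_pair (I : finType) (A B : {set I}) :
  (A :|: B = [set: I])%SET -> (A :&: B)%SET != finset.set0 ->
  #|[set f : {ffun I -> @cell d n} | injectiveb f &&
     (cell_cech (l n).+1 (f @: A)%SET && cell_cech (l n).+1 (f @: B)%SET)]%SET|%:R /
    (n.+1 ^ d)%:R ^+ #|I| @[n --> \oo] -->
  (r ^+ #|I|.-1 * (#|I|%:R + 2 * (#|(A :\: B)%SET| * #|(B :\: A)%SET|)%:R /
                            #|(A :&: B)%SET|.+1%:R)) ^+ d.
Proof.
move=> AB AB0; set V := (X in X ^+ d).
pose Q n (f : {ffun I -> @cell d n}) :=
  cell_cech (l n).+1 (f @: A)%SET && cell_cech (l n).+1 (f @: B)%SET.
pose M n : R := (n.+1 ^ d)%:R ^+ #|I|.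
have hi : #|[set f | Q n f]%SET|%:R / M n @[n --> \oo] --> V ^+ d.
  have := cvgn_exp _ _ d (cvgn_card_in_arc_pair lr r_half I A B AB AB0).
  apply: cvg_trans; apply: near_eq_cvg; apply: nearW => n /=.
  rewrite /M /Q card_cell_cech_pair natrX expr_div_n !natrX; congr (_ / _).
  by rewrite -!exprM mulnC.
have ff := cvgn_ffact (fun n => n.+1 ^ d)%N #|I|
  (fun n => (expn_gt0 n.+1 d)) cvgn_inv_succ_exp.
have lo : #|[set f | Q n f]%SET|%:R / M n + (((n.+1 ^ d) ^_ #|I|)%:R / M n - 1)
    @[n --> \oo] --> V ^+ d.
  rewrite -[V ^+ d]addr0 -[X in _ --> _ + X](subrr 1).
  by apply: cvgD => //; apply: cvgB; [exact: ff|exact: cvg_cst].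
apply: (squeeze_cvgr _ lo hi); apply: nearW => n.
have Mn : 0 < M n by rewrite exprn_gt0// ltr0n expn_gt0.
rewrite (_ : M n = (n.+1 ^ d)%:R ^+ #|I|)// in Mn *.
rewrite ler_pM2r ?invr_gt0// ler_nat; apply/andP; split; last first.
  by apply: subset_leq_card; apply/fintype.subsetP => f; rewrite !inE => /andP[].
rewrite -[X in _ + (_ - X)](divff (lt0r_neq0 Mn)) -mulrBl -mulrDl ler_pM2r ?invr_gt0//.
rewrite addrA lerBlDr -natrX -!natrD ler_nat.
by have := card_inj_ffun_ge I _ (Q n); rewrite card_cell.
Qed.

(** Each p^n pairs with the (N + 1)^(d n) of the map count to give mu^n. Since [p] tends to 0 and
    [A] meets [B], the factor 1 - p^|A :&: B| tends to 1, and [var_coefE] identifies what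
    remains. *)
Lemma cvgn_variance_term (p : nat -> R) (mu : R) (n : nat) :
  p N * (N.+1 ^ d)%:R @[N --> \oo] --> mu ->
  variance_term (fun S : {set @cell d N} => cell_cech (l N).+1 S) (p N) n
    @[N --> \oo] -->
  mu ^+ n * (r ^+ n.-1) ^+ d * var_coef R d n.
Proof.
move=> pmu.
have p_0 : p N @[N --> \oo] --> 0.
  have : p N * (N.+1 ^ d)%:R * ((N.+1 ^ d)%N%:R^-1) @[N --> \oo] --> mu * 0.
    by apply: cvgM => //; exact: cvgn_inv_succ_exp.
  rewrite mulr0; apply: cvg_trans; apply: near_eq_cvg; apply: nearW => N /=.
  by rewrite mulfK// pnatr_eq0 -lt0n expn_gt0.
rewrite -var_coefE -mulrA.
rewrite [X in _ * X]mulrCA big_distrr /=.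
pose F N (AB : {set 'I_n} * {set 'I_n}) : R :=
   #|[set f : {ffun 'I_n -> @cell d N} | injectiveb f &&
     (cell_cech (l N).+1 (f @: AB.1)%SET && cell_cech (l N).+1 (f @: AB.2)%SET)]%SET|%:R.
have : (p N * (N.+1 ^ d)%:R) ^+ n * ((n`!)%:R^-1 *
    \sum_(AB : {set 'I_n} * {set 'I_n} |
      (AB.1 :|: AB.2 == [set: 'I_n])%SET && ((AB.1 :&: AB.2)%SET != finset.set0))
     (-1) ^+ (#|AB.1| + #|AB.2|) * (1 - p N ^+ #|(AB.1 :&: AB.2)%SET|) *
     (F N AB / (N.+1 ^ d)%:R ^+ n)) @[N --> \oo] -->
   mu ^+ n * ((n`!)%:R^-1 *
    \sum_(AB : {set 'I_n} * {set 'I_n} |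
      (AB.1 :|: AB.2 == [set: 'I_n])%SET && ((AB.1 :&: AB.2)%SET != finset.set0))
     (-1) ^+ (#|AB.1| + #|AB.2|) * 1 *
      (r ^+ n.-1 * (n%:R + 2 * (#|(AB.1 :\: AB.2)%SET| * #|(AB.2 :\: AB.1)%SET|)%:R /
                            #|(AB.1 :&: AB.2)%SET|.+1%:R)) ^+ d).
  apply: cvgM; first exact: cvgn_exp.
  apply: cvgMl_tmp; apply: cvgn_sum => -[A B] /= /andP[/eqP AB AB0].
  apply: cvgM.
    apply: cvgMl_tmp; rewrite -[X in _ --> X]subr0; apply: cvgB; first exact: cvg_cst.
    have -> : (0 : R) = 0 ^+ #|(A :&: B)%SET|.
      by rewrite expr0n cards_eq0 (negbTE AB0).
    exact: cvgn_exp.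
  by have := cvgn_card_inj_cell_cech_pair 'I_n A B AB AB0; rewrite card_ord.
set L1 := (X in _ --> X -> _); set L2 := (X in _ -> _ --> X).
have -> : L1 = L2.
  rewrite /L1 /L2; congr (_ * (_ * _)); apply: eq_bigr => AB _.
  by rewrite exprMn; ring.
apply: cvg_trans; apply: near_eq_cvg; apply: nearW => N /=.
rewrite /variance_term exprMn -mulrA; congr (_ * _).
rewrite mulrCA; congr (_ * _); rewrite big_distrr /=; apply: eq_bigr => AB _.
rewrite mulrCA; congr (_ * _); rewrite mulrC mulfVK//.
Qed.

End GridLimits.

(** * Dominated convergence for series *)

Section Tannery.
Context {R : realType}.

(** Cut at an [m] where the remainder of [series b] is at most e / 3: the head is a finite sum of
    convergent sequences, and the remainder of [b] bounds both the tail of [v] and that of [u N]. *)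
Lemma tannery (u : nat -> nat -> R) (v b : nat -> R) (K : nat -> nat) :
  (forall N, N <= K N)%N -> (forall N n, `|u N n| <= b n) -> cvgn (series b) ->
  (forall n, u N n @[N --> \oo] --> v n) ->
  cvgn (series v) /\ \sum_(n < K N) u N n @[N --> \oo] --> limn (series v).
Proof.
move=> NK ub cb uv.
have vb n : `|v n| <= b n.
  have c : `|u N n| @[N --> \oo] --> `|v n| by apply: cvg_norm; exact: uv.
  by rewrite -(cvg_lim _ c)//; apply: limr_le; [apply/cvg_ex; eexists; exact: c|apply: nearW].
have b0 n : 0 <= b n by rewrite (le_trans _ (vb n)).
have cv : cvgn (series v).
  apply: normed_cvg; by apply: (@series_le_cvg _ _ b) => // n; exact: normr_ge0.
split=> //; set V := limn _.
have tail (w : nat -> R) m j : (forall n, `|w n| <= b n) -> (m <= j)%N ->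
    `|\sum_(m <= n < j) w n| <= limn (series b) - series b m.
  move=> wb mj; apply: (le_trans (ler_norm_sum _ _ _)).
  apply: (@le_trans _ _ (\sum_(m <= n < j) b n)); first exact: ler_sum.
  rewrite -sub_series_geq// lerD2r.
  by apply: nondecreasing_cvgn_le => //; apply: nondecreasing_series.
apply/cvgrPdist_le => e e0.
have e4 : 0 < e / 3 by rewrite divr_gt0.
have : \forall m \near \oo, `|limn (series b) - series b m| <= e / 3.
  by move/cvgrPdist_le : cb; exact.
move=> [m _ /(_ m (leqnn m)) bm].
have {}bm : limn (series b) - series b m <= e / 3 by rewrite (le_trans _ bm)// ler_norm.
have Vm : `|V - series v m| <= e / 3.
  have c : `|series v j - series v m| @[j --> \oo] --> `|V - series v m|.
    by apply: cvg_norm; apply: cvgB => //; exact: cvg_cst.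
  rewrite -(cvg_lim _ c)//; apply: limr_le; first by apply/cvg_ex; eexists; exact: c.
  exists m => // j /= mj; rewrite sub_series_geq//.
  exact: (le_trans (tail _ _ _ vb mj)).
have um : \sum_(n < m) u N n @[N --> \oo] --> \sum_(n < m) v n by apply: cvgn_sum.
move/cvgrPdist_le : um => /(_ _ e4) um.
near=> N.
have mN : (m <= K N)%N by apply: leq_trans (NK N); near: N; exists m.
have -> : \sum_(n < K N) u N n = \sum_(n < m) u N n + \sum_(m <= n < K N) u N n.
  by rewrite -!(big_mkord xpredT) -big_cat_nat.
have -> : V - (\sum_(n < m) u N n + \sum_(m <= n < K N) u N n) =
  (V - series v m) + (\sum_(n < m) v n - \sum_(n < m) u N n) - \sum_(m <= n < K N) u N n.
  by rewrite /series /= big_mkord; ring.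
have -> : e = e / 3 + e / 3 + e / 3 by field.
apply: (le_trans (ler_normB _ _)); apply: lerD.
  apply: (le_trans (ler_normD _ _)); apply: lerD => //.
  by near: N.
exact: (le_trans (tail _ _ _ (ub N) mN)).
Unshelve. all: by end_near. Qed.

End Tannery.

(** * Limit of the discrete variance *)

Section GridVariance.
Context {R : realType} {l : nat -> nat} {r : R} {d : nat}.
Hypothesis lr : (l n)%:R / n.+1%:R @[n --> \oo] --> r.
Hypothesis r_half : r < 2^-1.
Hypothesis d0 : (0 < d)%N.

Lemma cvgn_finite_variance (p : nat -> R) (mu : R) :
  (forall N, 0 <= p N <= 1) -> (forall N, p N * (N.+1 ^ d)%:R <= mu) ->
  p N * (N.+1 ^ d)%:R @[N --> \oo] --> mu ->
  let v n := mu ^+ n * (r ^+ n.-1) ^+ d * var_coef R d n in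
  cvgn (series v) /\
  finite_variance (fun S : {set @cell d N} => cell_cech (l N).+1 S) (p N)
    @[N --> \oo] --> limn (series v).
Proof.
move=> p01 pmu cpmu v.
have mu0 : 0 <= mu by rewrite (le_trans _ (pmu 0)) ?mulr_ge0//; case/andP: (p01 0).
(* More than the number of cells, so that [finite_varianceE] applies; positivity of [d] makes [K]
   grow at least like [N]. *)
pose K N := (N.+1 ^ d).+1.
pose u N n := variance_term (fun S : {set @cell d N} => cell_cech (l N).+1 S) (p N) n.
have -> : (fun N => finite_variance (fun S : {set @cell d N} => cell_cech (l N).+1 S) (p N)) =
    (fun N => \sum_(n < K N) u N n).
  by apply/funext => N; apply: finite_varianceE; rewrite card_cell.
(* [variance_term_bound] with p (N + 1)^d <= mu gives the exponential series at 4 mu as a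
   majorant. *)
apply: (tannery u v (exp_coeff (4 * mu)) K).
- by move=> N; rewrite /K; case: (d) d0 => // e _; rewrite expnS; have := expn_gt0 N.+1 e; nia.
- move=> N n; apply: (le_trans (variance_term_bound _ _ _ _ (p01 N))).
  rewrite card_cell /exp_coeff /= ler_pM2r ?invr_gt0 ?ltr0n ?fact_gt0//.
  have pM : 0 <= p N * (N.+1 ^ d)%:R by rewrite mulr_ge0//; case/andP: (p01 N).
  apply: lerXn2r; [by rewrite nnegrE mulr_ge0|by rewrite nnegrE mulr_ge0|].
  by rewrite ler_pM2l.
- exact: is_cvg_series_exp_coeff.
- by move=> n; exact: cvgn_variance_term.
Qed.

End GridVariance.
(** * Discretisation of the torus *)

Section CircleGrid.
Context {R : realType} {a eps : R}.
(* The index of the grid interval [k a / (N + 1), (k + 1) a / (N + 1)) of [0, a)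
   containing [x]. *)
Definition grid_index (N : nat) (x : R) : 'I_N.+1 :=
  inord (Num.truncn (x * N.+1%:R / a)).

(* The margin makes arcs of [(arc_length N).+1] grid intervals strictly shorter
   than [2 * eps] (once the truncated subtraction is exact). *)
Definition arc_length (N : nat) : nat := Num.truncn (2 * eps * N.+1%:R / a) - 2.

Lemma arc_lengthS (N : nat) : (2 <= Num.truncn (2 * eps * N.+1%:R / a))%N ->
  (arc_length N).+2 = Num.truncn (2 * eps * N.+1%:R / a).
Proof. by rewrite /arc_length; lia. Qed.

Hypothesis a0 : 0 < a.

Lemma grid_indexP (N : nat) (x : R) : 0 <= x < a ->
  (grid_index N x)%:R * a / N.+1%:R <= x < (grid_index N x).+1%:R * a / N.+1%:R.
Proof.
move=> /andP[x0 xa].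
have M0 : 0 < N.+1%:R :> R by rewrite ltr0n.
have q0 : 0 <= x * N.+1%:R / a by rewrite !mulr_ge0// ?invr_ge0 ltW.
have /andP[lo hi] := truncn_itv q0.
rewrite /grid_index inordK; last first.
  rewrite -(ltr_nat R); apply: (le_lt_trans lo).
  by rewrite ltr_pdivrMr// mulrC ltr_pM2l.
by rewrite ler_pdivrMr// -ler_pdivlMr// lo ltr_pdivlMr// -ltr_pdivrMr// hi.
Qed.

Hypothesis eps0 : 0 < eps.

Lemma cvgn_arc_length : (arc_length n)%:R / n.+1%:R @[n --> \oo] --> 2 * eps / a.
Proof.
pose c := 2 * eps / a.
have c0 : 0 < c by rewrite divr_gt0// mulr_gt0.
(* Truncation loses less than 1 and the margin in [arc_length] at most 2, hence the 3. *)
have lo : c - 3 * n.+1%:R^-1 @[n --> \oo] --> c.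
  rewrite -[X in _ --> X]subr0 -[X in _ --> _ - X](mulr0 3).
  by apply: cvgB; [exact: cvg_cst|apply: cvgMl_tmp; exact: cvgn_inv_succ].
have hi : (fun=> c) n @[n --> \oo] --> c by exact: cvg_cst.
apply: (squeeze_cvgr _ lo hi); apply: nearW => n.
have M0 : 0 < n.+1%:R :> R by rewrite ltr0n.
rewrite ler_pdivlMr// ler_pdivrMr// mulrBl mulfVK ?gt_eqF//.
have q0 : 0 <= c * n.+1%:R by rewrite mulr_ge0// ltW.
have /andP[tlo thi] := truncn_itv q0.
rewrite /arc_length (_ : 2 * eps * n.+1%:R / a = c * n.+1%:R); last by rewrite /c; ring.
apply/andP; split; last by apply: le_trans tlo; rewrite ler_nat leq_subr.
rewrite lerBlDr; apply: (le_trans (ltW thi)); rewrite -natrD ler_nat; lia.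
Qed.

(** The centre is the midpoint of the [L] grid intervals starting at [y0], which span at most 2 eps
    - h, with h the grid step. The shift [m] is 0 or 1 according to whether the index of [x] has
    wrapped past 0. *)
Lemma grid_arc_ball (N : nat) (y0 : 'I_N.+1) :
  (2 <= Num.truncn (2 * eps * N.+1%:R / a))%N ->
  exists y : R, forall x, 0 <= x < a ->
    ((grid_index N x - y0)%R < (arc_length N).+1)%N ->
    exists m : int, `|x - y + m%:~R * a| < eps.
Proof.
move=> t2; set L := (arc_length N).+1; pose h := a / N.+1%:R.
have M0 : 0 < N.+1%:R :> R by rewrite ltr0n.
have h0 : 0 < h by rewrite divr_gt0.
have aE : a = N.+1%:R * h by rewrite /h; field.
have Lh : L.+1%:R * h <= 2 * eps.
  rewrite /L arc_lengthS// /h mulrA ler_pdivrMr// -ler_pdivlMr//.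
  have q0 : 0 <= 2 * eps * N.+1%:R / a by rewrite !mulr_ge0// ?invr_ge0 ltW.
  by have /andP[] := truncn_itv q0.
exists ((y0%:R + L%:R / 2) * h) => x xa; have := grid_indexP N x xa.
set u := grid_index N x; rewrite -!mulrA -/h => /andP[ux xu].
rewrite -[L.+1]addn1 natrD mulrDl mul1r in Lh.
rewrite -[u.+1]addn1 natrD mulrDl mul1r in xu.
have yN := ltn_ord y0; rewrite val_ZpB; case: ifP => yu uL.
  exists 0; rewrite mul0r addr0.
  have k1 : u%:R * h <= (y0%:R + L%:R - 1) * h.
    by rewrite ler_pM2r// lerBrDr -!natrD natr1 ler_nat; clear -uL yu yN; lia.
  have k2 : y0%:R * h <= u%:R * h by rewrite ler_pM2r// ler_nat.
  rewrite ltr_norml !mulrDl mulNr mul1r in k1 *.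
  by apply/andP; split; lra.
exists 1; rewrite mul1r [X in _ - _ + X]aE.
have k1 : (u%:R + N.+1%:R) * h <= (y0%:R + L%:R - 1) * h.
  by rewrite ler_pM2r// lerBrDr -!natrD natr1 ler_nat; clear -uL yu yN; lia.
have k2 : y0%:R * h <= (u%:R + N.+1%:R) * h by rewrite ler_pM2r// -natrD ler_nat; clear -uL yu yN; lia.
rewrite ltr_norml !mulrDl mulNr mul1r in k1 k2 *.
by apply/andP; split; lra.
Qed.

Hypothesis eps_a : eps < a / 4.

Lemma arc_ratio_half : 2 * eps / a < 2^-1.
Proof. by rewrite ltr_pdivrMr//; move: eps_a; lra. Qed.


(** The arc starts at the grid interval containing y - delta, reduced modulo N + 1. The three grid
    steps of slack pay for rounding this start, for truncating 2 eps / h, and for the arc having one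
    point less than the truncated value. *)
Lemma ball_grid_arc (N : nat) (y delta : R) :
  2 * delta * N.+1%:R / a + 3 <= 2 * eps * N.+1%:R / a ->
  exists y0 : 'I_N.+1, forall x, 0 <= x < a ->
    (exists m : int, `|x - y + m%:~R * a| <= delta) ->
    ((grid_index N x - y0)%R < (arc_length N).+1)%N.
Proof.
move=> de; pose h := a / N.+1%:R.
have M0 : 0 < N.+1%:R :> R by rewrite ltr0n.
have h0 : 0 < h by rewrite divr_gt0.
have aE : a = N.+1%:R * h by rewrite /h; field.
pose A := (y - delta) / h; pose Y := Num.floor A.
have [YA AY] : Y%:~R <= A /\ A < Y%:~R + 1.
  by have /andP[] := floor_itv A; rewrite intrD1.
have yN : (`|(Y %% N.+1)%Z| < N.+1)%N.
  by rewrite -ltz_nat gez0_abs ?modz_ge0// ltz_pmod.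
exists (Ordinal yN) => x xa [m]; rewrite ler_norml => /andP[lo hi].
have := grid_indexP N x xa; rewrite -!mulrA -/h => /andP[].
set u := grid_index N x; rewrite -natr1 mulrDl mul1r => ux xu.
have Ah : A * h = y - delta by rewrite /A mulfVK ?gt_eqF.
have Yh : Y%:~R * h <= y - delta by rewrite -Ah ler_pM2r.
have hY : y - delta < Y%:~R * h + h.
  by rewrite -Ah -[X in _ < _ + X]mul1r -mulrDl ltr_pM2r.
have qE (z : R) : z * N.+1%:R / a = z / h by rewrite /h invf_div mulrA.
have de' : 2 * delta + 3 * h <= 2 * eps.
  move: de; rewrite !qE -(ler_pM2r h0) mulrDl !mulfVK ?gt_eqF//.
pose t := Num.truncn (2 * eps * N.+1%:R / a).
have q0 : 0 <= 2 * eps * N.+1%:R / a by rewrite !mulr_ge0// ?invr_ge0 ltW.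
have /andP[tlo thi] := truncn_itv q0.
have te : t%:R * h <= 2 * eps by rewrite -ler_pdivlMr// -qE.
have et : 2 * eps < t.+1%:R * h by rewrite -ltr_pdivrMr// -qE.
(* The offset of [x] from the start of the arc, lifted from Z/(N + 1) to the integers. *)
pose K : int := u%:Z + m * N.+1%:Z - Y.
have KE : K%:~R * h = u%:R * h + m%:~R * a - Y%:~R * h.
  by rewrite /K intrB intrD intrM [in RHS]aE; ring.
rewrite -natr1 mulrDl mul1r in et.
have K0 : 0 <= K.
  rewrite -ltzD1 -(ltr0z R) intrD1 -(pmulr_lgt0 _ h0) mulrDl mul1r KE; lra.
have Kt : K + 1 < t%:Z.
  rewrite -(ltr_int R) intrD1 -(ltr_pM2r h0) mulrDl mul1r KE -[t%:~R]/(t%:R); lra.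
have tN : (t <= N)%N.
  rewrite -ltnS -(ltr_nat R) -(ltr_pM2r h0) -aE; apply: (le_lt_trans te).
  by move: eps_a a0; lra.
have yE : ((Ordinal yN : nat) : int) = (Y %% N.+1)%Z by rewrite /= gez0_abs ?modz_ge0.
have YE := divz_eq Y N.+1; rewrite -yE in YE.
move: (Ordinal yN) (ltn_ord (Ordinal yN)) YE => y0 y0N YE.
rewrite -[(arc_length N).+1]/((arc_length N).+2.-1) arc_lengthS; last by move: Kt K0; rewrite /t; clear; lia.
rewrite -/t val_ZpB; have uN := ltn_ord u.
have KY : K = u%:Z - y0%:Z + (m - (Y %/ N.+1)%Z) * N.+1%:Z.
  by rewrite /K [in LHS]YE; ring.
move: (m - _) KY => q KY.
clear -uN y0N tN K0 Kt KY.
(* [u], [y0] and [K] all lie in [0, N + 1), so at most one turn is added; these are the two cases of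
   [val_ZpB]. *)
have [q0|q0] : q = 0 \/ q = 1.
  by nia.
all: by move: KY; rewrite q0 ?mul0r ?mul1r; case: ifP; clearbody K t u; clear h A Y; lia.
Qed.

End CircleGrid.

(** * Agreement of balls on the torus with arcs of cells *)

Section TorusGrid.
Context {R : realType} {a eps : R} {d : nat}.
Hypothesis a0 : 0 < a.
Hypothesis eps0 : 0 < eps.
Hypothesis eps_a : eps < a / 4.
Implicit Types (s w : {fset d.-tuple R}) (x y : d.-tuple R).

(** Here [f] will be a coordinate; points of [s] may share a value. Arcs give balls as soon as the
    grid is fine enough; conversely a ball leaves some room because [s] is finite, and a fine grid
    fits into this room. *)
Lemma near_grid_arc (T : choiceType) (s : {fset T}) (f : T -> R) :
  (forall v, v \in s -> 0 <= f v < a) ->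
  \forall N \near \oo,
    (exists y0 : 'I_N.+1, forall v, v \in s ->
      ((@grid_index R a N (f v) - y0)%R < (@arc_length R a eps N).+1)%N) <->
    (exists y : R, forall v, v \in s -> exists m : int, `|f v - y + m%:~R * a| < eps).
Proof.
move=> fa.
have large (c : R) : \forall N \near \oo, c <= N.+1%:R.
  apply: (filterS _ (nbhs_infty_ger c)) => N /= /le_trans; apply.
  by rewrite ler_nat.
have ball_of_arc : \forall N \near \oo,
    (exists y0 : 'I_N.+1, forall v, v \in s ->
      ((@grid_index R a N (f v) - y0)%R < (@arc_length R a eps N).+1)%N) ->
    (exists y : R, forall v, v \in s -> exists m : int, `|f v - y + m%:~R * a| < eps).
  apply: (filterS _ (large (2 * a / (2 * eps)))) => N aN [y0 sy0].
  have [|y yP] := grid_arc_ball a0 eps0 N y0.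
    have q0 : 0 <= 2 * eps * N.+1%:R / a by rewrite !mulr_ge0// ?invr_ge0 ltW.
    rewrite truncn_ge_nat// ler_pdivlMr//.
    by move: aN; rewrite ler_pdivrMr ?mulr_gt0// [N.+1%:R * _]mulrC.
  by exists y => v vs; apply: yP; [exact: fa|exact: sy0].
have [[y yP]|nbs] := pselect (exists y : R, forall v, v \in s ->
    exists m : int, `|f v - y + m%:~R * a| < eps); last first.
  by apply: (filterS _ ball_of_arc) => N ba; split.
have [m mP] : exists m : T -> int, forall v, v \in s -> `|f v - y + (m v)%:~R * a| < eps.
  suff /choice[m mP] : forall v, exists k : int, v \in s -> `|f v - y + k%:~R * a| < eps.
    by exists m.
  move=> v.
  by have [/yP[k vk]|vs] := boolP (v \in s); [exists k|exists 0].
(* The largest distance to the centre, strictly below [eps] as [s] is finite; the default 0 serves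
   for empty [s]. *)
pose delta : R := \big[Num.max/0]_(v <- s) `|f v - y + (m v)%:~R * a|.
have de : delta < eps.
  rewrite /delta big_seq_cond; elim/big_ind: _ => //.
    by move=> u v ue ve; rewrite gt_max ue ve.
  by move=> v /andP[vs _]; exact: mP.
have de0 : 0 < 2 * (eps - delta) by rewrite mulr_gt0 ?subr_gt0.
apply: (filterS2 _ _ ball_of_arc (large (3 * a / (2 * (eps - delta))))) => N ba aN.
split=> // _.
have [|y0 y0P] := ball_grid_arc a0 eps0 eps_a N y delta.
  rewrite -lerBrDl -mulrBl ler_pdivlMr// -mulrBl -mulrBr.
  by move: aN; rewrite ler_pdivrMr// [N.+1%:R * _]mulrC.
exists y0 => v vs; apply: y0P; first exact: fa.
exists (m v).
by apply: (le_bigmax_seq 0 v xpredT (fun v => `|f v - y + (m v)%:~R * a|) vs).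
Qed.

(** The shift is chosen independently in each coordinate, so the infimum of maxima decouples; the
    default 0 of the maximum is below [eps] since [eps] is positive. *)
Lemma torus_dist_ltP x y :
  torus_dist a x y < eps <->
  forall i, exists m : int, `|tnth x i - tnth y i + m%:~R * a| < eps.
Proof.
rewrite /torus_dist; split=> [/inf_lt[]|dxy].
- by exists (\big[Num.max/0]_(i < d) `|tnth x i - tnth y i + (0 : int)%:~R * a|); exists (fun=> 0).
- by move=> _ [m _ <-] /bigmax_ltP[_ mP] i; exists (m i); exact: mP.
have [m mP] := choice dxy.
apply: (le_lt_trans (y := \big[Num.max/0]_(i < d) `|tnth x i - tnth y i + (m i)%:~R * a|)).
  apply: ge_inf; last by exists m.
  by exists 0 => _ [k _ <-]; exact: bigmax_ge_id.
by apply/bigmax_ltP; split.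
Qed.

Lemma torus_balls_meetP s :
  (\bigcap_(v in [set` s]) torus_ball a v eps !=set0) <->
  forall i, exists y : R, forall v, v \in s ->
    exists m : int, `|tnth v i - y + m%:~R * a| < eps.
Proof.
split=> [[y yP] i|sP].
  exists (tnth y i) => v vs; have [_ /torus_dist_ltP] := yP v vs; exact.
have [y yP] := choice sP.
(* Whole turns to subtract so that the common point lies in the fundamental domain [0, a)^d. *)
pose q i := Num.floor (y i / a).
exists [tuple y i - (q i)%:~R * a | i < d] => v vs; split.
  move=> i; rewrite tnth_mktuple.
  have /andP[lo hi] := floor_itv (y i / a).
  move: lo hi; rewrite ler_pdivlMr// ltr_pdivrMr// intrD1 mulrDl mul1r => lo hi.
  by apply/andP; split; lra.
apply/torus_dist_ltP => i; have [m vm] := yP i v vs.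
exists (m - q i); rewrite tnth_mktuple intrB.
by move: vm; congr (`|_| < _); ring.
Qed.

Definition cell_of (N : nat) (x : d.-tuple R) : @cell d N :=
  [ffun i => @grid_index R a N (tnth x i)].

Definition occupied (N : nat) s : {set @cell d N} :=
  [set cell_of N (val v) | v : s]%SET.

Lemma near_cell_cech s : (forall x, x \in s -> torus a x) ->
  \forall N \near \oo, cell_cech (@arc_length R a eps N).+1 (occupied N s) =
    `[< \bigcap_(v in [set` s]) torus_ball a v eps !=set0 >].
Proof.
move=> sa.
have : \forall N \near \oo, forall i : 'I_d,
    (exists y0 : 'I_N.+1, forall v, v \in s ->
      ((@grid_index R a N (tnth v i) - y0)%R < (@arc_length R a eps N).+1)%N) <->
    (exists y : R, forall v, v \in s -> exists m : int, `|tnth v i - y + m%:~R * a| < eps).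
  by apply: filter_forall => i; apply: near_grid_arc => v /sa.
apply: filterS => N NP; apply/idP/asboolP.
  move=> /forallP sN; apply/torus_balls_meetP => i; apply/NP.
  have /existsP[y0 /fintype.subsetP sy0] := sN i.
  exists y0 => v vs; have := sy0 (cell_of N v i).
  rewrite !inE ffunE; apply; apply/imsetP; exists (cell_of N v); rewrite ?ffunE//.
  by apply/imsetP; exists [` vs]%fset.
move=> /torus_balls_meetP sP; apply/forallP => i.
have /NP[y0 sy0] := sP i.
apply/existsP; exists y0; apply/fintype.subsetP => _ /imsetP[_ /imsetP[v _ ->] ->].
by rewrite inE ffunE; apply: sy0; exact: valP.
Qed.

(** Two points differing in a coordinate are separated once a / (N + 1) is at most that difference;
    finitely many pairs are involved. *)
Lemma near_cell_of_inj s : (forall x, x \in s -> torus a x) ->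
  \forall N \near \oo, {in s &, injective (cell_of N)}.
Proof.
move=> sa.
have : \forall N \near \oo, forall xy : s * s,
    cell_of N (val xy.1) = cell_of N (val xy.2) -> val xy.1 = val xy.2.
  apply: filter_forall => -[x y] /=.
  have [->|] := eqVneq (val x) (val y); first exact: nearW.
  move=> /eqP xy.
  have [i /eqP xyi] : exists i, tnth (val x) i <> tnth (val y) i.
    apply: contrapT => /forallNP xyi; apply: xy; apply: eq_from_tnth => i.
    by apply: contrapT; exact: xyi.
  have xy0 : 0 < `|tnth (val x) i - tnth (val y) i| by rewrite normr_gt0 subr_eq0.
  apply: (filterS _ (nbhs_infty_ger (a / `|tnth (val x) i - tnth (val y) i|))) => N /= aN.
  move=> /(congr1 (fun u : cell N => u i)); rewrite !ffunE => e; exfalso.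
  have M0 : 0 < N.+1%:R :> R by rewrite ltr0n.
  have /andP[lo1 hi1] := grid_indexP a0 N (tnth (val x) i) (sa _ (valP x) i).
  have /andP[lo2 hi2] := grid_indexP a0 N (tnth (val y) i) (sa _ (valP y) i).
  have : `|tnth (val x) i - tnth (val y) i| < a / N.+1%:R.
    rewrite ltr_norml; move: lo1 hi1 lo2 hi2; rewrite e -!natr1 -!mulrA !mulrDl !mul1r.
    by move=> *; apply/andP; split; lra.
  rewrite ltNge => /negP; apply.
  rewrite ler_pdivrMr//; move: aN; rewrite ler_pdivrMr// => /le_trans; apply.
  by rewrite mulrC ler_pM2l// ler_nat.
apply: filterS => N NP x y xs ys; exact: (NP ([` xs]%fset, [` ys]%fset)).
Qed.

End TorusGrid.

(** * The Euler characteristic as a sum over sets of cells *)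

Section EulerChar.
Context {R : realType} {a eps : R} {d : nat}.
Implicit Types (s w : {fset d.-tuple R}).

Definition cell_euler (N L : nat) (O : {set @cell d N}) : R :=
  \sum_(S in powerset O) simplex_weight (fun S => cell_cech L S) S.

Lemma card_occupied (N : nat) s : {in s &, injective (@cell_of R a d N)} ->
  #|@occupied R a d N s| = #|` s|.
Proof.
move=> cI; rewrite /occupied card_in_imset ?cardfE// => x y _ _ /cI e.
by apply/val_inj/e; exact: valP.
Qed.

Lemma mem_occupied (N : nat) s (u : @cell d N) :
  reflect (exists2 x, x \in s & u = @cell_of R a d N x) (u \in @occupied R a d N s).
Proof.
apply: (iffP imsetP) => [[x _ ->]|[x xs ->]]; first by exists (val x) => //; exact: valP.
by exists [` xs]%fset.
Qed.

Lemma sum_subsets_occupied (N : nat) s (V : zmodType) (F : {set @cell d N} -> V) :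
  {in s &, injective (@cell_of R a d N)} ->
  \sum_(S in powerset (@occupied R a d N s)) F S =
  \sum_(w <- fpowerset s) F (@occupied R a d N w).
Proof.
move=> cI; rewrite -big_enum -(big_map (@occupied R a d N) xpredT F) /=.
apply: perm_big; apply: uniq_perm; first exact: enum_uniq.
  rewrite map_inj_in_uniq ?fset_uniq// => v w; rewrite !fpowersetE.
  move=> /fsubsetP vs /fsubsetP ws e; apply/fsetP => x.
  apply/idP/idP => xv.
    have /mem_occupied : @cell_of R a d N x \in @occupied R a d N w.
      by rewrite -e; apply/mem_occupied; exists x.
    by case=> y yw /(cI x y (vs _ xv) (ws _ yw)) ->.
  have /mem_occupied : @cell_of R a d N x \in @occupied R a d N v.
    by rewrite e; apply/mem_occupied; exists x.
  by case=> y yv /(cI x y (ws _ xv) (vs _ yv)) ->.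
move=> S; rewrite mem_enum powersetE; apply/fintype.subsetP/mapP => [SO|[w]].
  exists [fset x in s | @cell_of R a d N x \in S]%fset.
    by rewrite fpowersetE; exact: fset_sub.
  apply/setP => u; apply/idP/mem_occupied => [uS|[x]].
    have /mem_occupied[x xs ux] := SO _ uS.
    by exists x => //; rewrite !inE/= xs -ux.
  by rewrite !inE/= => /andP[_ xS] ->.
rewrite fpowersetE => /fsubsetP ws -> u /mem_occupied[x xw ->].
by apply/mem_occupied; exists x => //; exact: ws.
Qed.

(** Exchanging the sums, a simplex [w] contributes only at i = |w| - 1, which is below |s| because
    [w] is a nonempty subset of [s]. *)
Lemma euler_charE s : (euler_char a eps s)%:~R =
  \sum_(w <- fpowerset s) (if w == fset0 then 0 else
    (-1) ^+ #|` w|.+1 * `[< \bigcap_(v in [set` w]) torus_ball a v eps !=set0 >]%:R) :> R.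
Proof.
pose h w := `[< \bigcap_(v in [set` w]) torus_ball a v eps !=set0 >].
transitivity (\sum_(w <- cech a eps s) (-1) ^+ #|` w|.+1 : R); last first.
  rewrite /cech -big_fset_condE big_mkcond /=; apply: eq_bigr => w _.
  by case: eqP => //= _; case: ifP => _; rewrite ?mulr1 ?mulr0.
rewrite /euler_char rmorph_sum /=.
transitivity (\sum_(i < #|` s|) \sum_(w <- cech a eps s) (if #|` w| == i.+1 then (-1) ^+ i else 0 : R)).
  apply: eq_bigr => i _; rewrite -big_mkcond /= intrM -pmulrn.
  have -> : nb_simplices a eps s i = (\sum_(w <- cech a eps s | #|` w| == i.+1) 1)%N.
    by rewrite /nb_simplices card_fset_sum1 [RHS]big_fset_condE.
  rewrite natr_sum big_distrr /=; apply: eq_bigr => w _.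
  by rewrite mulr1 rmorphXn rmorphN1.
rewrite exchange_big /= big_seq [RHS]big_seq; apply: eq_bigr => w.
rewrite /cech !inE /= fpowersetE => /and3P[/fsubset_leq_card ws].
rewrite -cardfs_gt0 => w0 _.
have wn : (#|` w|.-1 < #|` s|)%N by apply: leq_trans ws; rewrite prednK.
rewrite (bigD1 (Ordinal wn)) //= prednK// eqxx big1 ?addr0; last first.
  move=> i; rewrite -val_eqE /= => iw; case: eqP => // wi.
  by move: iw; rewrite wi eqxx.
by rewrite -[in RHS](prednK w0) !exprS mulrA mulrNN !mul1r.
Qed.

Lemma euler_char_occupied (N L : nat) s : {in s &, injective (@cell_of R a d N)} ->
  (forall w, (w `<=` s)%fset -> cell_cech L (@occupied R a d N w) =
     `[< \bigcap_(v in [set` w]) torus_ball a v eps !=set0 >]) ->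
  (euler_char a eps s)%:~R = cell_euler N L (@occupied R a d N s).
Proof.
move=> cI hE; rewrite euler_charE /cell_euler (sum_subsets_occupied N s)//.
rewrite big_seq [RHS]big_seq; apply: eq_bigr => w; rewrite fpowersetE => ws.
have cw : #|@occupied R a d N w| = #|` w|.
  by apply: card_occupied => x y /(fsubsetP ws) xs /(fsubsetP ws); exact: cI.
by rewrite /simplex_weight -cards_eq0 cw cardfs_eq0 hE.
Qed.

Hypothesis a0 : 0 < a.
Hypothesis eps0 : 0 < eps.
Hypothesis eps_a : eps < a / 4.

(** The threshold depends on [s], so the approximation is only pointwise in the sample; convergence
    of moments requires a dominating function. *)
Lemma near_euler_char s : (forall x, x \in s -> torus a x) ->
  \forall N \near \oo, (euler_char a eps s)%:~R =
    cell_euler N (@arc_length R a eps N).+1 (@occupied R a d N s).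
Proof.
move=> sa.
have hE : \forall N \near \oo, forall w : fpowerset s,
    cell_cech (@arc_length R a eps N).+1 (@occupied R a d N (val w)) =
    `[< \bigcap_(v in [set` val w]) torus_ball a v eps !=set0 >].
  apply: filter_forall => w; apply: near_cell_cech => // x xw; apply: sa.
  by have := valP w; rewrite fpowersetE => /fsubsetP; exact.
apply: (filterS2 _ _ hE (near_cell_of_inj a0 s sa)) => N {}hE cI.
apply: euler_char_occupied => // w ws.
have ws' : w \in fpowerset s by rewrite fpowersetE.
exact: (hE [` ws']%fset).
Qed.

Lemma cell_euler_bound (N L : nat) (O : {set @cell d N}) : `|cell_euler N L O| <= 2 ^+ #|O|.
Proof.
apply: (le_trans (ler_norm_sum _ _ _)).
rewrite -natrX -card_powerset -sum1_card natr_sum; apply: ler_sum => S _.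
rewrite /simplex_weight; case: eqP => _; first by rewrite normr0.
rewrite normrM normrX normrN1 expr1n mul1r normr_nat.
by case: (cell_cech _ _).
Qed.

Lemma card_occupied_le (N : nat) s : (#|@occupied R a d N s| <= #|` s|)%N.
Proof. by rewrite cardfE; apply: leq_trans (leq_imset_card _ _) (max_card _). Qed.

End EulerChar.
(** * The law of the occupied cells *)

Section LebesgueBox.
Context {R : realType}.

Lemma lebesgue_tuple_set0 (n : nat) : lebesgue_tuple (set0 : set (n.-tuple R)) = 0%E.
Proof.
elim: n => [|n IH] /=; first by rewrite diracE in_set0.
under eq_integral => x _ do rewrite (_ : [set v : n.-tuple R | set0 [tuple of x :: v]] = set0)// IH.
by rewrite integral0.
Qed.

Lemma lebesgue_tuple_box (n : nat) (lo hi : 'I_n -> R) : (forall i, lo i <= hi i) ->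
  lebesgue_tuple [set x : n.-tuple R | forall i, lo i <= tnth x i < hi i] =
  (\prod_i (hi i - lo i))%:E.
Proof.
elim: n lo hi => [|n IH] lo hi lohi /=.
  rewrite big_ord0 diracE mem_set// => -[].
  by [].
set c : R := \prod_(i < n) (hi (lift ord0 i) - lo (lift ord0 i)).
transitivity (\int[lebesgue_measure]_(x in `[lo ord0, hi ord0[) (cst c%:E x))%E.
  rewrite [RHS]integral_mkcond; apply: eq_integral => x _.
  rewrite /patch mem_setE in_itv /=; case: ifPn => x0.
    rewrite -IH; last by move=> i; exact: lohi.
    congr lebesgue_tuple; apply/seteqP; split=> v /= vP i.
      by have := vP (lift ord0 i); rewrite tnthS.
    by case: (unliftP ord0 i) => [j|] ->; [rewrite tnthS|rewrite tnth0].
  rewrite -[RHS](lebesgue_tuple_set0 n); congr lebesgue_tuple.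
  apply/seteqP; split=> v //= /(_ ord0); rewrite tnth0 => H.
  by rewrite H in x0.
rewrite integral_cst//= lebesgue_measure_itv /= big_ord_recl -/c.
case: ifPn => [_|]; first by rewrite -EFinD -EFinM mulrC.
rewrite lte_fin -leNgt => h; have -> : hi ord0 = lo ord0 by apply/eqP; rewrite eq_le h lohi.
by rewrite subrr mul0r mule0.
Qed.

Lemma measurable_tuple_box (n : nat) (lo hi : 'I_n -> R) :
  measurable [set x : n.-tuple R | forall i, lo i <= tnth x i < hi i].
Proof.
have -> : [set x : n.-tuple R | forall i, lo i <= tnth x i < hi i] =
    \bigcap_(i in [set: 'I_n]) (@tnth n R ^~ i @^-1` `[lo i, hi i[).
  by apply/seteqP; split=> x xP i; [move=> _ /=|]; have := xP i; rewrite /= in_itv //; apply.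
apply: fin_bigcap_measurable => // i _; rewrite -[X in measurable X]setTI.
by apply: measurable_tnth.
Qed.

End LebesgueBox.
Section OccupancyLaw.
Context {R : realType} {disp : measure_display} {Omega : measurableType disp}.
Context {P : probability Omega R} {d : nat} {a lambda : R}.
Context {omega : Omega -> {fset d.-tuple R}}.
Hypothesis a0 : 0 < a.
Hypothesis lambda0 : 0 < lambda.
Hypothesis poisson_omega : poisson_process P a lambda omega.

Definition cell_box (N : nat) (u : @cell d N) : set (d.-tuple R) :=
  [set x | torus a x /\ @cell_of R a d N x = u].

Lemma cell_boxE (N : nat) (u : @cell d N) :
  cell_box N u = [set x | forall i,
    (u i)%:R * (a / N.+1%:R) <= tnth x i < (u i).+1%:R * (a / N.+1%:R)].
Proof.
have h0 : 0 < a / N.+1%:R by rewrite divr_gt0.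
have aE : a = N.+1%:R * (a / N.+1%:R) by field.
apply/seteqP; split=> x /=.
  by move=> [xa <-] i; rewrite ffunE !mulrA; exact: grid_indexP.
move=> xu; have xa : torus a x.
  move=> i; have /andP[lo hi] := xu i; apply/andP; split.
    by apply: le_trans lo; rewrite mulr_ge0// ltW.
  apply: (lt_le_trans hi); rewrite [leRHS]aE ler_pM2r// ler_nat; exact: ltn_ord.
split=> //; apply/ffunP => i; rewrite ffunE; apply/val_inj/eqP.
have /andP[lo hi] := xu i.
have /andP[] := grid_indexP a0 N (tnth x i) (xa i); rewrite -!mulrA => lo' hi'.
have := le_lt_trans lo hi'; have := le_lt_trans lo' hi.
by rewrite !ltr_pM2r// !ltr_nat !ltnS eqn_leq => -> ->.
Qed.

Lemma measurable_cell_box (N : nat) (u : @cell d N) : measurable (cell_box N u).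
Proof. by rewrite cell_boxE; exact: measurable_tuple_box. Qed.

Lemma cell_box_torus (N : nat) (u : @cell d N) : cell_box N u `<=` torus a.
Proof. by move=> x []. Qed.

Lemma lebesgue_cell_box (N : nat) (u : @cell d N) :
  fine (lebesgue_tuple (cell_box N u)) = (a / N.+1%:R) ^+ d.
Proof.
have h0 : 0 < a / N.+1%:R by rewrite divr_gt0.
rewrite cell_boxE lebesgue_tuple_box /=; last by move=> i; rewrite ler_pM2r// ler_nat.
rewrite (eq_bigr (fun=> a / N.+1%:R)); first by rewrite prodr_const card_ord.
by move=> i _; rewrite -mulrBl -natrB ?leqnSn// subSnn mul1r.
Qed.

Lemma measurable_torus : measurable (torus a : set (d.-tuple R)).
Proof. exact: (measurable_tuple_box d (fun=> 0) (fun=> a)). Qed.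

Lemma lebesgue_torus : fine (lebesgue_tuple (torus a : set (d.-tuple R))) = a ^+ d.
Proof.
rewrite (lebesgue_tuple_box d (fun=> 0) (fun=> a)) /=; last by move=> _; exact: ltW.
by rewrite prodr_const card_ord subr0.
Qed.

(** One minus the Poisson probability of an empty cell, whose mean number of points is [lambda]
    times its volume. *)
Definition occupied_prob (N : nat) : R := 1 - expR (- (lambda * (a / N.+1%:R) ^+ d)).

Lemma count_in_gt0 (A : set (d.-tuple R)) t :
  (0 < count_in omega A t)%N <-> exists2 x, x \in omega t & A x.
Proof.
rewrite /count_in cardfs_gt0; split=> [/fset0Pn[x]|[x xw Ax]].
  by rewrite !inE => /andP[xw /set_mem Ax]; exists x.
by apply/fset0Pn; exists x; rewrite !inE /= xw; exact: mem_set.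
Qed.

Lemma occupied_count (N : nat) (u : @cell d N) t :
  u \in @occupied R a d N (omega t) <-> (0 < count_in omega (cell_box N u) t)%N.
Proof.
have [wa _ _ _] := poisson_omega.
split=> [/mem_occupied[x xw ->]|/count_in_gt0[x xw [_ <-]]].
  by apply/count_in_gt0; exists x => //; split=> //; exact: (wa t).
by apply/mem_occupied; exists x.
Qed.

Lemma prob_cell_occupied (N : nat) (u : @cell d N) :
  P (count_in omega (cell_box N u) @^-1` [set k | (0 < k)%N]) = (occupied_prob N)%:E.
Proof.
have [_ _ wP _] := poisson_omega.
rewrite wP; [|exact: measurable_cell_box|exact: cell_box_torus].
rewrite lebesgue_cell_box; set mu := lambda * _.
have mu0 : 0 < mu by rewrite mulr_gt0// exprn_gt0// divr_gt0.
rewrite (_ : [set k | (0 < k)%N] = ~` [set 0%N]); last first.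
  by apply/seteqP; split=> k /=; rewrite lt0n => /eqP.
rewrite (probability_setC (poisson_prob mu 0%N)) //.
rewrite /occupied_prob -/mu EFinB; congr (_ - _)%E.
transitivity (\esum_(k in [set 0%N]) (poisson_pmf mu k)%:E)%E.
  by rewrite /= /poisson_prob ifT.
rewrite esum_set1 ?lee_fin ?poisson_pmf_ge0//.
by rewrite /poisson_pmf mu0 expr0 fact0 invr1 !mul1r.
Qed.

Definition all_occupied (N : nat) (S : {set @cell d N}) : set Omega :=
  [set t | S \subset @occupied R a d N (omega t)].

(** Independence is assumed for families indexed by ordinals, so the event is written over all
    enumerated cells, with a trivial condition outside [S]. *)
Lemma all_occupiedE (N : nat) (S : {set @cell d N}) :
  all_occupied N S = \bigcap_(i in [set: 'I_#|@cell d N|])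
    (count_in omega (cell_box N (enum_val i)) @^-1`
       (if enum_val i \in S then [set k | (0 < k)%N] else setT)).
Proof.
apply/seteqP; split=> t /=.
  move=> /fintype.subsetP St i _ /=; case: ifP => // uS.
  by apply/occupied_count; exact: St.
move=> tS; apply/fintype.subsetP => u uS; apply/occupied_count.
by have := tS (enum_rank u) I; rewrite /= enum_rankK uS.
Qed.

Lemma measurable_all_occupied (N : nat) (S : {set @cell d N}) :
  measurable (all_occupied N S).
Proof.
have [_ wm _ _] := poisson_omega.
rewrite all_occupiedE; apply: fin_bigcap_measurable => // i _.
rewrite -[X in measurable X]setTI; apply: wm => //.
  exact: measurable_cell_box.
exact: cell_box_torus.
Qed.

Lemma prob_all_occupied (N : nat) (S : {set @cell d N}) :
  fine (P (all_occupied N S)) = occupied_prob N ^+ #|S|.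
Proof.
have [_ _ _ wi] := poisson_omega.
rewrite all_occupiedE wi.
- rewrite (reindex (@enum_rank (@cell d N))) /=; last first.
    exact/onW_bij/enum_rank_bij.
  rewrite (bigID (mem S)) /= [X in _ * X]big1 ?mulr1; last first.
    move=> u uS; rewrite enum_rankK (negbTE uS) preimage_setT.
    by rewrite probability_setT.
  rewrite -prodr_const; apply: eq_bigr => u uS.
  by rewrite enum_rankK uS prob_cell_occupied.
- by move=> i; exact: measurable_cell_box.
- by move=> i; exact: cell_box_torus.
- by move=> i j _ _ [x [[_ xi] [_ xj]]]; apply: enum_val_inj; rewrite -xi.
Qed.

End OccupancyLaw.
(** * Moments *)

Section FiniteMoments.
Context {R : realType} {disp : measure_display} {Omega : measurableType disp}.
Context {P : probability Omega R}.

Lemma integral_sum_indic (I : finType) (c : I -> R) (E : I -> set Omega) :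
  (forall i, measurable (E i)) ->
  (\int[P]_t (\sum_i c i * \1_(E i) t)%:E = (\sum_i c i * fine (P (E i)))%:E)%E.
Proof.
move=> mE.
have intE i : P.-integrable setT (fun t => ((c i)%:E * (\1_(E i) t)%:E)%E).
  by apply: integrableZl => //; exact: integrable_indic.
under eq_integral => t _ do rewrite -sumEFin.
transitivity (\int[P]_t (\sum_i (c i)%:E * (\1_(E i) t)%:E)%E)%E.
  by apply: eq_integral => t _; apply: eq_bigr => i _; rewrite EFinM.
rewrite integral_sum// -sumEFin; apply: eq_bigr => i _.
rewrite integralZl//; last exact: integrable_indic.
by rewrite integral_indic// setIT EFinM fineK// fin_num_measure.
Qed.

Lemma Lfun2_of_integrable_sqr (f : Omega -> R) : measurable_fun setT f ->
  P.-integrable setT (fun t => (f t ^+ 2)%:E) -> f \in Lfun P 2%:E.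
Proof.
move=> mf /integrableP[_ f2]; rewrite inE; apply/andP; split; rewrite inE//=.
rewrite /finite_norm unlock /Lnorm poweR_lty//.
rewrite (eq_integral (fun t => `|(f t ^+ 2)%:E|)%E)// => t _.
by rewrite /= powR_mulrn// normrX.
Qed.

End FiniteMoments.

(** * Integrable bound and moments of the discrete Euler characteristic *)

Section ChiMoments.
Context {R : realType} {disp : measure_display} {Omega : measurableType disp}.
Context {P : probability Omega R} {d : nat} {a lambda : R}.
Context {omega : Omega -> {fset d.-tuple R}}.
Hypothesis a0 : 0 < a.
Hypothesis lambda0 : 0 < lambda.
Hypothesis poisson_omega : poisson_process P a lambda omega.

Lemma count_in_torus t : count_in omega (torus a) t = #|` omega t|.
Proof.
have [wa _ _ _] := poisson_omega; rewrite /count_in; congr (#|` _|).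
apply/fsetP => x; rewrite !inE /=; case: (boolP (x \in omega t)) => //= /wa xt.
by rewrite mem_set.
Qed.

Lemma measurable_nb_points (f : nat -> R) : measurable_fun setT (fun t => f #|` omega t|).
Proof.
have [_ wm _ _] := poisson_omega.
have -> : (fun t => f #|` omega t|) = f \o count_in omega (torus a).
  by apply/funext => t /=; rewrite count_in_torus.
apply: measurableT_comp => //.
exact: (wm _ measurable_torus).
Qed.

(** Splitting by the number of points gives expR (- mu) times the exponential series at 4 mu. The
    base 4 is the square of the 2 in [cell_euler_bound]. *)
Lemma integral_pow4_nb_points :
  P.-integrable setT (fun t => (4 ^+ #|` omega t|)%:E).
Proof.
have [_ wm wP _] := poisson_omega.
pose n t := count_in omega (torus a) t.
have mu0 : 0 < lambda * a ^+ d by rewrite mulr_gt0// exprn_gt0.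
set mu := lambda * a ^+ d in mu0.
have nP k : P (n @^-1` [set k]) = (mu ^+ k * k`!%:R^-1 * expR (- mu))%:E.
  rewrite wP//; last exact: measurable_torus.
  rewrite lebesgue_torus// -/mu.
  transitivity (\esum_(j in [set k]) (poisson_pmf mu j)%:E)%E.
    by rewrite /= /poisson_prob ifT.
  by rewrite esum_set1 ?lee_fin ?poisson_pmf_ge0// /poisson_pmf mu0.
have m4 : measurable_fun setT (fun t => (4 ^+ #|` omega t|)%:E : \bar R).
  by apply/measurable_EFinP; exact: (measurable_nb_points (fun k => 4 ^+ k)).
apply/integrableP; split=> //.
have mn k : measurable (n @^-1` [set k]).
  by rewrite -[X in measurable X]setTI; apply: wm => //; exact: measurable_torus.
have nT : \bigcup_k (n @^-1` [set k]) = setT.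
  by apply/seteqP; split=> // t _; exists (n t).
under eq_integral => t _ do rewrite abse_EFin ger0_norm ?exprn_ge0//.
rewrite -nT ge0_integral_bigcup//; last 2 first.
- by rewrite nT.
- by move=> i j _ _ [t [/= -> ->]].
rewrite (eq_eseriesr (g := fun k => ((expR (- mu))%:E * (exp_coeff (4 * mu) k)%:E)%E)); last first.
  move=> k _; transitivity (\int[P]_(t in n @^-1` [set k]) (cst (4 ^+ k)%:E t))%E.
    by apply: eq_integral => t /set_mem /= <-; rewrite /n count_in_torus.
  transitivity ((4 ^+ k)%:E * P (n @^-1` [set k]))%E; first exact: integral_cst.
  rewrite nP -!EFinM; congr (_%:E).
  rewrite /exp_coeff /= [(4 * mu) ^+ k]exprMn; clear; clearbody mu.
  by ring.
rewrite nneseriesZl; last first.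
  by move=> k _; rewrite lee_fin exp_coeff_ge0// mulr_ge0// ltW.
rewrite (_ : (\sum_(0 <= k <oo) (exp_coeff (4 * mu) k)%:E)%E = (expR (4 * mu))%:E) ?ltry//.
rewrite expRE -EFin_lim; last first.
  rewrite /pseries/=; under eq_fun do rewrite mulrC.
  exact: is_cvg_series_exp_coeff.
apply/congr_lim/funext => k/=; rewrite /pseries/= /series/= -sumEFin//.
by apply: eq_bigr => i _; rewrite /exp_coeff /= mulrC.
Qed.

Lemma cell_euler_indic (N L : nat) t :
  @cell_euler R d N L (@occupied R a d N (omega t)) =
  \sum_(S : {set @cell d N}) simplex_weight (fun S => cell_cech L S) S *
     \1_(@all_occupied R disp Omega d a omega N S) t.
Proof.
rewrite /cell_euler big_mkcond /=; apply: eq_bigr => S _; rewrite powersetE indicE.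
have -> : (t \in @all_occupied R disp Omega d a omega N S) = (S \subset @occupied R a d N (omega t)).
  by apply/idP/idP => [/set_mem|h]; [|exact/mem_set].
by case: ifP => _; rewrite ?mulr1 ?mulr0.
Qed.

Lemma measurable_cell_euler (N L : nat) :
  measurable_fun setT (fun t => @cell_euler R d N L (@occupied R a d N (omega t))).
Proof.
under eq_fun do rewrite cell_euler_indic.
apply: measurable_sum => S; apply: measurable_funM; first exact: measurable_cst.
by apply: measurable_indic; exact: (measurable_all_occupied a0 poisson_omega).
Qed.

(** The events for [S] and [T] intersect in the event for their union, which gives the second
    moment. The real witnesses record that both integrals are finite. *)
Lemma cell_euler_variance (N L : nat) :
  exists e1 e2 : R,
  [/\ (\int[P]_t (@cell_euler R d N L (@occupied R a d N (omega t)))%:E = e1%:E)%E,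
     (\int[P]_t (@cell_euler R d N L (@occupied R a d N (omega t)) ^+ 2)%:E = e2%:E)%E &
     e2 - e1 ^+ 2 = finite_variance (fun S : {set @cell d N} => cell_cech L S)
       (@occupied_prob R d a lambda N)].
Proof.
pose w (S : {set @cell d N}) : R := simplex_weight (fun S => cell_cech L S) S.
pose p := @occupied_prob R d a lambda N.
have mE := measurable_all_occupied a0 poisson_omega N.
have pE := prob_all_occupied a0 lambda0 poisson_omega N.
exists (\sum_S w S * p ^+ #|S|), (\sum_(ST : {set @cell d N} * {set @cell d N})
   w ST.1 * w ST.2 * p ^+ #|(ST.1 :|: ST.2)%SET|); split.
- under eq_integral do rewrite cell_euler_indic.
  rewrite integral_sum_indic//; congr (_%:E).
  by apply: eq_bigr => S _; rewrite pE.
- transitivity (\int[P]_t (\sum_(ST : {set @cell d N} * {set @cell d N})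
     w ST.1 * w ST.2 * \1_(@all_occupied R disp Omega d a omega N (ST.1 :|: ST.2)%SET) t)%:E)%E.
    apply: eq_integral => t _; rewrite cell_euler_indic expr2 big_distrlr /= pair_big /=.
    congr (_%:E); apply: eq_bigr => -[S T] _ /=.
    rewrite mulrACA; congr (_ * _); rewrite -[LHS]/((_ \* _) t) -indicI.
    congr (\1__ _); apply/seteqP; split=> x; rewrite /all_occupied /= finset.subUset.
      by move=> [-> ->].
    by move=> /andP[].
  rewrite integral_sum_indic//; congr (_%:E).
  by apply: eq_bigr => ST _; rewrite pE.
rewrite expr2 big_distrlr /= pair_big /= -sumrB /finite_variance.
by apply: eq_bigr => ST _; rewrite /w /p exprD mulrBr mulrACA.
Qed.

End ChiMoments.

(** * Asymptotics of the occupation probability *)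

Section OccupiedProb.
Context {R : realType} {d : nat} {a lambda : R}.
Hypothesis a0 : 0 < a.
Hypothesis lambda0 : 0 < lambda.
Hypothesis d0 : (0 < d)%N.
Let p := @occupied_prob R d a lambda.

Lemma occupied_prob_rate_gt0 (N : nat) : 0 < lambda * (a / N.+1%:R) ^+ d.
Proof. by rewrite mulr_gt0// exprn_gt0// divr_gt0. Qed.

Lemma occupied_prob_itv (N : nat) : 0 <= p N <= 1.
Proof.
rewrite /p /occupied_prob subr_ge0 lerBlDr lerDl expR_ge0 andbT.
by rewrite -[leRHS]expR0 ler_expR oppr_le0 ltW ?occupied_prob_rate_gt0.
Qed.

Lemma occupied_prob_rateE (N : nat) :
  lambda * (a / N.+1%:R) ^+ d * (N.+1 ^ d)%:R = lambda * a ^+ d.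
Proof. by rewrite expr_div_n natrX -mulrA divfK// expf_neq0. Qed.

Lemma occupied_prob_le (N : nat) : p N * (N.+1 ^ d)%:R <= lambda * a ^+ d.
Proof.
rewrite -(occupied_prob_rateE N) ler_wpM2r// /p /occupied_prob lerBlDr.
by have := expR_ge1Dx (- (lambda * (a / N.+1%:R) ^+ d)); lra.
Qed.

(** Squeeze from x / (1 + x) <= 1 - exp (- x) <= x, where x is the mean number of points in a cell
    and tends to 0. *)
Lemma cvgn_occupied_prob : p N * (N.+1 ^ d)%:R @[N --> \oo] --> lambda * a ^+ d.
Proof.
set mu := lambda * a ^+ d.
pose x N := lambda * (a / N.+1%:R) ^+ d.
have x_0 : x N @[N --> \oo] --> (0 : R).
  have : mu * ((N.+1 ^ d)%:R^-1) @[N --> \oo] --> mu * 0.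
    by apply: cvgMl_tmp; exact: cvgn_inv_succ_exp.
  rewrite mulr0; apply: cvg_trans; apply: near_eq_cvg; apply: nearW => N /=.
  by rewrite /mu -(occupied_prob_rateE N) mulfK// pnatr_eq0 -lt0n expn_gt0.
have lo : mu * (1 + x N)^-1 @[N --> \oo] --> mu.
  have : mu * (1 + x N)^-1 @[N --> \oo] --> mu * (1 + 0)^-1.
    apply: cvgMl_tmp; apply: cvgV; first by rewrite addr0 oner_neq0.
    by apply: cvgD => //; exact: cvg_cst.
  by rewrite addr0 invr1 mulr1.
have hi : (fun=> mu) N @[N --> \oo] --> mu by exact: cvg_cst.
apply: (squeeze_cvgr _ lo hi); apply: nearW => N; rewrite occupied_prob_le andbT.
have x0 : 0 < x N := occupied_prob_rate_gt0 N.
rewrite /mu -(occupied_prob_rateE N) mulrAC ler_wpM2r// /p /occupied_prob -/(x N).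
rewrite ler_pdivrMr; last lra.
have := expR_ge1Dx (x N); have e0 := expR_gt0 (x N); rewrite expRN => ex.
rewrite mulrBl mul1r.
have : (expR (x N))^-1 * (1 + x N) <= 1 by rewrite ler_pdivrMl// mulr1.
lra.
Qed.

End OccupiedProb.

(** * Passage to the limit and identification of the variance *)

Theorem theorem16 (R : realType) (d : nat) (a lambda eps : R)
    (disp : measure_display) (Omega : measurableType disp)
    (P : probability Omega R) (omega : Omega -> {fset d.-tuple R}) :
  (1 <= d)%N -> 0 < a -> 0 < lambda -> 0 < eps -> eps < a / 4 ->
  poisson_process P a lambda omega ->
  let chi (t : Omega) : R := (euler_char a eps (omega t))%:~R in
  let partial_sum (N : nat) : R :=
    \sum_(1 <= n < N) var_coef R d n * (lambda * (2 * eps) ^+ d) ^+ (n - 1) in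
  [/\ chi \in Lfun P 2%:E,
      cvgn partial_sum
    & 'V_P[chi]%E = (lambda * a ^+ d * limn partial_sum)%:E].
Proof.
move=> d0 a0 lambda0 eps0 eps_a poisson_omega chi partial_sum.
have [wa _ _ _] := poisson_omega.
pose X N t : R := @cell_euler R d N (@arc_length R a eps N).+1 (@occupied R a d N (omega t)).
(* At a fixed sample the sequence is eventually constant, equal to [chi t]; measurability of [chi]
   then follows from that of the [X N]. *)
have X_chi t : X N t @[N --> \oo] --> chi t.
  apply: cvg_near_cst; apply: (filterS _ (near_euler_char a0 eps0 eps_a (omega t) (wa t))).
  by move=> N /esym.
have mX N : measurable_fun setT (X N) by exact: (measurable_cell_euler a0 poisson_omega).
have mchi : measurable_fun setT chi := measurable_fun_cvg mX (fun t _ => X_chi t).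
have Xle N t : `|X N t| <= 2 ^+ #|` omega t|.
  apply: (le_trans (cell_euler_bound _ _ _)).
  by rewrite ler_weXn2l ?ler1n// card_occupied_le.
have sqr4 t (x : R) : `|x| <= 2 ^+ #|` omega t| -> `|x ^+ 2| <= 4 ^+ #|` omega t|.
  move=> xt; rewrite normrX.
  have -> : 4 ^+ #|` omega t| = (2 ^+ #|` omega t|) ^+ 2 :> R.
    by rewrite -exprM mulnC exprM; congr (_ ^+ _); ring.
  by apply: lerXn2r; rewrite ?nnegrE ?exprn_ge0.
have g1 (N : nat) (t : Omega) : setT t -> (`|(X N t)%:E| <= (4 ^+ #|` omega t|)%:E)%E.
  move=> _; rewrite abse_EFin lee_fin; apply: (le_trans (Xle N t)).
  by apply: lerXn2r; rewrite ?nnegrE// ler_nat.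
have g2 (N : nat) (t : Omega) : setT t -> (`|(X N t ^+ 2)%:E| <= (4 ^+ #|` omega t|)%:E)%E.
  by move=> _; rewrite abse_EFin lee_fin sqr4.
have ig := integral_pow4_nb_points a0 lambda0 poisson_omega.
have chi2 : chi \in Lfun P 2%:E.
  apply: Lfun2_of_integrable_sqr => //.
  apply: (le_integrable measurableT _ _ ig).
    by apply/measurable_EFinP; exact: measurable_funX.
  move=> t _; rewrite !abse_EFin lee_fin [leRHS]ger0_norm ?exprn_ge0//; apply: sqr4.
  (* [chi t] is one of the values [X N t], so it inherits their bound. *)
  have [N _ XN] := near_euler_char a0 eps0 eps_a (omega t) (wa t).
  by have -> : chi t = X N t := XN N (leqnn N).
have chi1 : chi \in Lfun P 1 by apply: Lfun_subset12 chi2; exact: fin_num_measure.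
have cE1 : (\int[P]_t (X N t)%:E)%E @[N --> \oo] --> (\int[P]_t (chi t)%:E)%E.
  apply: (dominated_cvg measurableT (g := fun t => (4 ^+ #|` omega t|)%:E)) => //.
    by move=> N; exact/measurable_EFinP.
  by move=> t _; apply/fine_cvgP; split; [exact: nearW|exact: X_chi].
have cE2 : (\int[P]_t (X N t ^+ 2)%:E)%E @[N --> \oo] --> (\int[P]_t (chi t ^+ 2)%:E)%E.
  apply: (dominated_cvg measurableT (g := fun t => (4 ^+ #|` omega t|)%:E)) => //.
    by move=> N; apply/measurable_EFinP; exact: measurable_funX.
  by move=> t _; apply/fine_cvgP; split; [exact: nearW|apply: cvgn_exp; exact: X_chi].
have fE1 : (\int[P]_t (chi t)%:E)%E \is a fin_num.
  by have := expectation_fin_num chi1; rewrite unlock.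
have fE2 : (\int[P]_t (chi t ^+ 2)%:E)%E \is a fin_num.
  exact: (integrable_fin_num measurableT (Lfun2_integrable_sqr chi2)).
set E1 := (\int[P]_t (chi t)%:E)%E in cE1 fE1.
set E2 := (\int[P]_t (chi t ^+ 2)%:E)%E in cE2 fE2.
pose p := @occupied_prob R d a lambda.
(* First evaluation of the limit: the moments of [X N] converge to those of [chi] by domination. *)
have cvar : finite_variance (fun S : {set @cell d N} => cell_cech (@arc_length R a eps N).+1 S) (p N)
    @[N --> \oo] --> fine E2 - fine E1 ^+ 2.
  have : fine (\int[P]_t (X N t ^+ 2)%:E)%E - fine (\int[P]_t (X N t)%:E)%E ^+ 2
      @[N --> \oo] --> fine E2 - fine E1 ^+ 2.
    apply: cvgB; first by apply: fine_cvg; rewrite fineK.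
    by apply: cvgn_exp; apply: fine_cvg; rewrite fineK.
  apply: cvg_trans; apply: near_eq_cvg; apply: nearW => N /=.
  have [e1 [e2 [-> -> <-]]] := cell_euler_variance a0 lambda0 poisson_omega N (@arc_length R a eps N).+1.
  by [].
pose mu := lambda * a ^+ d.
have mu0 : 0 < mu by rewrite mulr_gt0// exprn_gt0.
(* Second evaluation of the same limit, by counting, with r = 2 eps / a; uniqueness of limits then
   equates the two. *)
have [cv cvar'] := cvgn_finite_variance (cvgn_arc_length a0 eps0) (arc_ratio_half a0 eps_a) d0
  p mu (occupied_prob_itv a0 lambda0) (@occupied_prob_le R d a lambda) (cvgn_occupied_prob a0 lambda0 d0).
pose v n := mu ^+ n * ((2 * eps / a) ^+ n.-1) ^+ d * var_coef R d n.
have psE : partial_sum = (fun N => mu^-1 * series v N).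
  apply/funext => N; rewrite /series /= /partial_sum.
  (* For n = 0 the range of [j] in [var_coef] is empty, so the series may start at 1. *)
  have v0 : v 0%N = 0 by rewrite /v /var_coef big_geq ?mulr0.
  have -> : \sum_(0 <= n < N) v n = \sum_(1 <= n < N) v n.
    case: N => [|N]; first by rewrite !big_geq.
    by rewrite big_nat_recl// v0 add0r [RHS]big_add1.
  rewrite big_distrr /= big_nat [RHS]big_nat; apply: eq_bigr => n /andP[n1 _].
  rewrite /v -(prednK n1) subn1 /= exprS.
  rewrite -exprM mulnC exprM -/mu.
  (* Hence mu^n (2 eps / a)^(d (n - 1)) is mu times the power of lambda (2 eps)^d in the
     statement. *)
  have -> : lambda * (2 * eps) ^+ d = mu * (2 * eps / a) ^+ d.
    by rewrite /mu expr_div_n; field; rewrite expf_neq0 ?gt_eqF.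
  move: (mu) (lt0r_neq0 mu0) (_ ^+ d) => m m0 q.
  by rewrite [(m * q) ^+ _]exprMn -!mulrA mulKf// [LHS]mulrC -mulrA.
have cps : partial_sum N @[N --> \oo] --> mu^-1 * limn (series v).
  by rewrite psE; apply: cvgMl_tmp.
split=> //; first by apply/cvg_ex; eexists; exact: cps.
rewrite (cvg_lim _ cps)// -/mu mulVKf ?gt_eqF//.
rewrite (cvg_unique _ cvar' cvar)// varianceE// [in LHS]unlock.
by rewrite EFinB EFin_expe !fineK.
Qed.
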